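(* Let $A$ and $B$ be finite dimensional $k$-algebras and $\Lambda:=A\otimes_k B$. Suppose that $B$ is Gorenstein. Then $\Lambda\text{-}\mathsf{Gproj}=\mathsf{Mon}(B, A\text{-}\mathsf{Gproj})$ if and only if $\mathrm{gldim}(B)<\infty$.
   Context: $k$ is a fixed field; all algebras are nonzero finite dimensional $k$-algebras; $\otimes=\otimes_k$; modules are finitely generated left modules unless stated otherwise. $D=\mathrm{Hom}_k(-,k)$. Subcategories are full and closed under isomorphism. An algebra $\Gamma$ is Gorenstein if ${}_\Gamma\Gamma$ and $\Gamma_\Gamma$ both have finite injective dimension; $\mathrm{gldim}$ is global dimension. A $\Gamma$-module $G$ is Gorenstein projective if there is an exact complex $P^\bullet=(\cdots\to P^{i}\xrightarrow{d^i}P^{i+1}\to\cdots)$ of finitely generated projective $\Gamma$-modules with $G=\mathrm{Ker}\,d^1$ such that $\mathrm{Hom}_\Gamma(P^\bullet,{}_\Gamma\Gamma)$ is exact; $\Gamma\text{-}\mathsf{Gproj}$ is the full subcategory of $\Gamma\text{-mod}$ of Gorenstein projective modules. $\mathsf{Mon}(B,A)$ is the full subcategory of $\Lambda\text{-mod}$ consisting of the modules $X$ with $\mathrm{Tor}_i^{\Lambda}(A\otimes D(S),X)=0$ for all $i\ge 1$ and all simple left $B$-modules $S$. For a full additive subcategory $\mathscr{L}$ of $A\text{-mod}$, $\mathsf{Mon}(B,\mathscr{L})$ is the full subcategory of those $X\in\mathsf{Mon}(B,A)$ such that the left $A$-module $(A\otimes V)\otimes_\Lambda X$ lies in $\mathscr{L}$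 for every finitely generated right $B$-module $V$. *)

(* Defs.v *)
From HB Require Import structures.
From mathcomp Require Import all_boot all_order all_algebra all_field.

Set Implicit Arguments.
Unset Strict Implicit.
Unset Printing Implicit Defensive.

Import GRing.Theory VectorInternalTheory.
Local Open Scope ring_scope.

(** * The opposite of a finite dimensional algebra *)

Section Opposite.
Variables (k : fieldType) (A : falgType k).

HB.instance Definition _ := GRing.Lmodule.copy A^c A.
HB.instance Definition _ := Vector.copy A^c A.
HB.instance Definition _ := GRing.Lmodule_isLalgebra.Build k A^c
  (fun c (u v : A) => scalerAr c v u).
HB.instance Definition _ := GRing.Lalgebra_isAlgebra.Build k A^c
  (fun c (u v : A) => scalerAl c v u).
End Opposite.

Section LinearFacts.
Variables (k : fieldType) (U U' : vectType k) (f : U -> U').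
Hypothesis f_lin : linear f.

Let F : {linear U -> U'} :=
  HB.pack f (GRing.isLinear.Build k U U' *:%R f f_lin).

Lemma linear_comb (I : finType) (c : I -> k) (x : I -> U) :
  f (\sum_i c i *: x i) = \sum_i c i *: f (x i).
Proof.
rewrite -[f]/(F : _ -> _) linear_sum; apply: eq_bigr => i _; exact: linearZ.
Qed.

Lemma linfun_linE x : linfun f x = f x.
Proof. by rewrite -[f]/(F : _ -> _) lfunE. Qed.

End LinearFacts.

(** * Tensor product over k of finite dimensional vector spaces *)

(* With respect to the bases [tbase V] and [tbase W], an element of the tensor
   product is its matrix of coordinates; [tlift_pure] and [tlift_uniq]
   give the universal property. *)
Definition tens (k : fieldType) (V W : vectType k) : Type :=
  'M[k]_(dim V, dim W).

HB.instance Definition _ (k : fieldType) (V W : vectType k) :=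
  Vector.copy (tens V W) 'M[k]_(dim V, dim W).

Definition bilinear_map (k : fieldType) (V W U : vectType k)
    (f : V -> W -> U) : Prop :=
  (forall v, linear (f v)) /\ (forall w, linear (f^~ w)).

Section Tensor.
Variables (k : fieldType) (V W : vectType k).

Definition tbase (V : vectType k) (i : 'I_(dim V)) : V := r2v (delta_mx 0 i).

Definition tpure (v : V) (w : W) : tens V W :=
  \matrix_(i, j) (v2r v 0 i * v2r w 0 j).

Section Lift.
Variables (U : vectType k) (f : V -> W -> U).

Definition tlift_fun (x : tens V W) : U :=
  \sum_i \sum_j x i j *: f (tbase i) (tbase j).

Fact tlift_fun_is_linear : linear tlift_fun.
Proof.
move=> c x y; rewrite /tlift_fun scaler_sumr -big_split /=.
apply: eq_bigr => i _; rewrite scaler_sumr -big_split /=.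
by apply: eq_bigr => j _; rewrite !mxE scalerDl scalerA.
Qed.
HB.instance Definition _ :=
  GRing.isLinear.Build k (tens V W) U *:%R tlift_fun tlift_fun_is_linear.

Definition tlift : 'Hom(tens V W, U) := linfun tlift_fun.

Lemma tliftE x : tlift x = \sum_i \sum_j x i j *: f (tbase i) (tbase j).
Proof. by rewrite lfunE. Qed.

End Lift.

Lemma tbase_expand (v : V) : v = \sum_i v2r v 0 i *: tbase i.
Proof.
apply: (can_inj v2rK); rewrite {1}[v2r v]row_sum_delta linear_sum /=.
by apply: eq_bigr => i _; rewrite linearZ /= r2vK.
Qed.

Lemma tpure_bilinear : bilinear_map tpure.
Proof.
split=> [v c x y|w c x y]; apply/matrixP=> i j; rewrite !mxE linearP !mxE.
  by rewrite mulrDr mulrCA.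
by rewrite mulrDl mulrA.
Qed.

End Tensor.

Section TensorTheory.
Variables (k : fieldType) (V W : vectType k).

Lemma tpure_base i j :
  tpure (tbase i) (tbase j) = delta_mx i j :> 'M_(dim V, dim W).
Proof. by apply/matrixP=> a b; rewrite !mxE !r2vK !mxE !eqxx /= -natrM mulnb. Qed.

Lemma tens_expand (x : tens V W) :
  x = \sum_i \sum_j x i j *: tpure (tbase i) (tbase j).
Proof.
rewrite {1}[x]matrix_sum_delta; apply: eq_bigr => i _; apply: eq_bigr => j _.
by rewrite tpure_base.
Qed.


Lemma tlift_pure (U : vectType k) (f : V -> W -> U) v w :
  bilinear_map f -> tlift f (tpure v w) = f v w.
Proof.
case=> fr fl; rewrite tliftE {2}[v]tbase_expand (linear_comb (fl w)).
apply: eq_bigr => i _; rewrite {2}[w]tbase_expand (linear_comb (fr _)) scaler_sumr.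
by apply: eq_bigr => j _; rewrite !mxE scalerA.
Qed.

Lemma tlift_uniq (U : vectType k) (f g : 'Hom(tens V W, U)) :
  (forall v w, f (tpure v w) = g (tpure v w)) -> f = g.
Proof.
move=> fg; apply/lfunP=> x; rewrite [x]tens_expand !linear_sum.
apply: eq_bigr => i _; rewrite !linear_sum; apply: eq_bigr => j _.
by rewrite !linearZ /= fg.
Qed.

Lemma tens_ind (P : tens V W -> Prop) :
    (forall v w, P (tpure v w)) ->
    (forall c x y, P x -> P y -> P (c *: x + y)) ->
  forall x, P x.
Proof.
move=> Ppure Plin x; rewrite [x]tens_expand.
have P0 : P 0.
  suff <- : tpure 0 0 = 0 :> tens V W by exact: Ppure.
  by apply/matrixP=> i j; rewrite !mxE linear0 mxE mul0r.
elim/big_ind: _ => // [y z Py Pz|i _]; first by rewrite -[y]scale1r; apply: Plin.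
elim/big_ind: _ => // [y z Py Pz|j _]; first by rewrite -[y]scale1r; apply: Plin.
by rewrite -[_ *: _]addr0; apply: Plin.
Qed.

End TensorTheory.

Section TensorMap.
Variables (k : fieldType) (V V' W W' : vectType k).

Definition tmap (f : 'Hom(V, V')) (g : 'Hom(W, W')) :
    'Hom(tens V W, tens V' W') :=
  tlift (fun v w => tpure (f v) (g w)).

Lemma tmap_pure f g v w : tmap f g (tpure v w) = tpure (f v) (g w).
Proof.
have [pr pl] := tpure_bilinear V' W'.
rewrite /tmap tlift_pure //; split=> [u|u] c x y; rewrite /= linearP.
  exact: pr.
exact: pl.
Qed.

End TensorMap.

(** * The tensor product algebra *)

Definition talg (k : fieldType) (A B : falgType k) : Type := tens A B.

HB.instance Definition _ (k : fieldType) (A B : falgType k) :=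
  Vector.copy (talg A B) (tens A B).

Section TensorAlgebra.
Variables (k : fieldType) (A B : falgType k).
Implicit Types x y z : tens A B.

(* Left multiplication by x, determined by
   (a \otimes b) (a' \otimes b') = a a' \otimes b b'. *)
Definition tmull : 'Hom(tens A B, 'End(tens A B)) :=
  tlift (fun a b => tmap (amull a) (amull b)).

Definition tone : tens A B := tpure 1 1.

Lemma tmap_bilinear (V V' W W' : vectType k) :
  bilinear_map (@tmap k V V' W W').
Proof.
have [pr pl] := tpure_bilinear V' W'.
by split=> [f|f] c g h; apply: tlift_uniq => v w;
  rewrite !(add_lfunE, scale_lfunE, tmap_pure) ?pr ?pl.
Qed.

Lemma tmull_pure a b a' b' :
  tmull (tpure a b) (tpure a' b') = tpure (a * a') (b * b').
Proof.
have [pr pl] := tmap_bilinear A A B B.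
rewrite /tmull tlift_pure; first by rewrite tmap_pure !lfunE.
by split=> [u|u] c x y; rewrite linearP ?pr ?pl.
Qed.

Fact tmulA : associative (fun x y => tmull x y).
Proof.
move=> x y z; elim/tens_ind: x => [a b|c x x' IHx IHx']; last first.
  by rewrite !(linearP, add_lfunE, scale_lfunE) /= IHx IHx'.
elim/tens_ind: y => [a' b'|c y y' IHy IHy']; last first.
  by rewrite !(linearP, add_lfunE, scale_lfunE) /= IHy IHy'.
elim/tens_ind: z => [a'' b''|c z z' IHz IHz']; last first.
  by rewrite !linearP /= IHz IHz'.
by rewrite !tmull_pure !mulrA.
Qed.

Fact tmul1l : left_id tone (fun x y => tmull x y).
Proof.
by elim/tens_ind => [a b|c x y IHx IHy]; rewrite ?tmull_pure ?mul1r // linearP /= IHx IHy.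
Qed.

Fact tmul1r : right_id tone (fun x y => tmull x y).
Proof.
elim/tens_ind => [a b|c x y IHx IHy]; rewrite ?tmull_pure ?mulr1 //.
by rewrite linearP add_lfunE scale_lfunE IHx IHy.
Qed.

Fact tmulDl : left_distributive (fun x y => tmull x y) +%R.
Proof. by move=> x y z; rewrite linearD add_lfunE. Qed.

Fact tmulDr : right_distributive (fun x y => tmull x y) +%R.
Proof. by move=> x y z; rewrite linearD. Qed.

Fact tone_neq0 : tone != 0.
Proof.
have v2r1_neq0 (C : falgType k) : exists i, v2r (1 : C) 0 i != 0.
  apply/existsP; rewrite -negb_forall; apply/negP=> /forallP v2r1_0.
  have /eqP[] := oner_neq0 C; apply: (can_inj v2rK); rewrite linear0.
  by apply/rowP=> i; rewrite mxE; apply/eqP.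
have [[i i_neq0] [j j_neq0]] := (v2r1_neq0 A, v2r1_neq0 B).
apply/eqP=> /matrixP/(_ i j); rewrite !mxE => /eqP.
by rewrite mulf_eq0 (negPf i_neq0) (negPf j_neq0).
Qed.

HB.instance Definition _ := GRing.Zmodule_isNzRing.Build (talg A B)
  tmulA tmul1l tmul1r tmulDl tmulDr tone_neq0.

Fact tscalerAl (c : k) (x y : talg A B) :
  c *: tmull x y = tmull (c *: x) y.
Proof. by rewrite linearZ scale_lfunE. Qed.

Fact tscalerAr (c : k) (x y : talg A B) :
  c *: tmull x y = tmull x (c *: y).
Proof. by rewrite linearZ. Qed.

HB.instance Definition _ :=
  GRing.Lmodule_isLalgebra.Build k (talg A B) tscalerAl.
HB.instance Definition _ :=
  GRing.Lalgebra_isAlgebra.Build k (talg A B) tscalerAr.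
HB.instance Definition _ := Algebra_isFalgebra.Build k (talg A B).

Lemma talg_mulE (x y : talg A B) : x * y = tmull x y.
Proof. by []. Qed.

End TensorAlgebra.

(** * Modules *)

(* Over a finite dimensional k-algebra, the finitely generated modules are the
   finite dimensional ones: a left module is a finite dimensional vector space
   carrying a unital k-linear action. Right R-modules are left R^c-modules. *)
Record fdmod (k : fieldType) (R : falgType k) := FdMod {
  mod_space :> vectType k;
  act : R -> 'End(mod_space);
  act_linear : linear act;
  act1 : act 1 = \1%VF;
  actM : forall r s : R, act (r * s) = (act r \o act s)%VF
}.

Definition rmod (k : fieldType) (R : falgType k) := fdmod R^c.

Section Modules.
Variables (k : fieldType) (R : falgType k).
Implicit Types M N X : fdmod R.

Definition modhom M N (f : 'Hom(M, N)) : Prop :=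
  forall r x, f (act M r x) = act N r (f x).

Definition zero_mod M : Prop := fullv = 0%VS :> {vspace M}.

Definition simple_mod M : Prop :=
  ~ zero_mod M /\
  forall U : {vspace M}, (forall r, act M r @: U <= U)%VS ->
    U = 0%VS \/ U = fullv.

Definition projective_mod (P : fdmod R) : Prop :=
  forall M N (p : 'Hom(M, N)) (f : 'Hom(P, N)),
    modhom p -> modhom f -> limg p = fullv ->
  exists2 g : 'Hom(P, M), modhom g & (p \o g)%VF = f.

(* By Baer's criterion, testing against finitely generated modules is enough. *)
Definition injective_mod (I : fdmod R) : Prop :=
  forall M N (i : 'Hom(M, N)) (f : 'Hom(M, I)),
    modhom i -> modhom f -> lker i = 0%VS ->
  exists2 g : 'Hom(N, I), modhom g & (g \o i)%VF = f.

(* ... -> P 1 -> P 0 -> X -> 0 *)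
Record proj_resolution X (P : nat -> fdmod R)
    (d : forall n, 'Hom(P n.+1, P n)) (e : 'Hom(P 0, X)) : Prop := {
  pres_proj : forall n, projective_mod (P n);
  pres_hom : forall n, modhom (d n);
  pres_aug : modhom e;
  pres_surj : limg e = fullv;
  pres_exact0 : limg (d 0) = lker e;
  pres_exact : forall n, limg (d n.+1) = lker (d n)
}.

(* 0 -> X -> I 0 -> I 1 -> ... *)
Record inj_resolution X (I : nat -> fdmod R)
    (d : forall n, 'Hom(I n, I n.+1)) (e : 'Hom(X, I 0)) : Prop := {
  ires_inj : forall n, injective_mod (I n);
  ires_hom : forall n, modhom (d n);
  ires_aug : modhom e;
  ires_mono : lker e = 0%VS;
  ires_exact0 : limg e = lker (d 0);
  ires_exact : forall n, limg (d n) = lker (d n.+1)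
}.

Definition projdim_le X (n : nat) : Prop :=
  exists P d e, @proj_resolution X P d e /\
    forall m, (n < m)%N -> zero_mod (P m).

Definition injdim_le X (n : nat) : Prop :=
  exists I d e, @inj_resolution X I d e /\
    forall m, (n < m)%N -> zero_mod (I m).

Fact regmod_actM (r s : R) : amull (r * s) = (amull r \o amull s)%VF.
Proof. by apply/lfunP=> x; rewrite comp_lfunE !lfunE /= mulrA. Qed.

Fact regmod_act_linear : linear (@amull k R).
Proof. by move=> c r s; rewrite linearP. Qed.

Definition regmod : fdmod R :=
  @FdMod k R R (@amull k R) regmod_act_linear (amull1 R) regmod_actM.

(* The embedding j identifies G with Ker (d 1). *)
Definition Gproj (G : fdmod R) : Prop :=
  exists (P : int -> fdmod R) (d : forall i, 'Hom(P i, P (i + 1))),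
  [/\ forall i, projective_mod (P i),
      forall i, modhom (d i),
      forall i, limg (d i) = lker (d (i + 1)),
      forall i (f : 'Hom(P (i + 1), regmod)),
        modhom f -> (f \o d i)%VF = 0 ->
        exists2 g : 'Hom(P (i + 1 + 1), regmod),
          modhom g & f = (g \o d (i + 1))%VF
    & exists2 j : 'Hom(G, P 1),
        modhom j & lker j = 0%VS /\ limg j = lker (d 1)].

End Modules.

(* The global dimension of a Noetherian ring is the supremum of the projective
   dimensions of its finitely generated modules, on either side. *)
Definition gldim_finite (k : fieldType) (R : falgType k) : Prop :=
  exists n, forall X : fdmod R, projdim_le X n.

(* Right modules are left R^c-modules, so regmod R^c is R as a right module. *)
Definition Gorenstein (k : fieldType) (R : falgType k) : Prop :=
  (exists n, injdim_le (regmod R) n) /\ (exists n, injdim_le (regmod R^c) n).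

Section Dual.
Variables (k : fieldType) (R : falgType k) (M : fdmod R).

Definition dual_act (r : R^c) : 'End('Hom(M, k^o)) :=
  linfun (fun f : 'Hom(M, k^o) => (f \o act M r)%VF).

Lemma dual_actE (r : R^c) (f : 'Hom(M, k^o)) :
  dual_act r f = (f \o act M r)%VF.
Proof.
by apply: linfun_linE => c g h; rewrite comp_lfunDl comp_lfunZl.
Qed.

Fact dual_act_linear : linear dual_act.
Proof.
move=> c r s; apply/lfunP=> f; rewrite add_lfunE scale_lfunE !dual_actE.
by rewrite (@act_linear _ _ M) comp_lfunDr comp_lfunZr.
Qed.

Fact dual_act1 : dual_act 1 = \1%VF.
Proof. by apply/lfunP=> f; rewrite dual_actE id_lfunE act1 comp_lfun1r. Qed.

Fact dual_actM (r s : R^c) : dual_act (r * s) = (dual_act r \o dual_act s)%VF.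
Proof.
apply/lfunP=> f; rewrite comp_lfunE !dual_actE -comp_lfunA.
by rewrite -(@actM _ _ M).
Qed.

(* D(M) = Hom_k(M, k), with (f r)(x) = f (r x). *)
Definition dual : rmod R := FdMod dual_act_linear dual_act1 dual_actM.

End Dual.

(** * Tensor product of modules over an algebra *)

Section Quotient.
Variables (k : fieldType) (V : vectType k) (U : {vspace V}).

(* The quotient V / U, realised on a complement of U. *)
Definition quotv : vectType k := subvs_of (U^C)%VS.

Definition qproj : 'Hom(V, quotv) :=
  (linfun (@vsproj k V (U^C)%VS) \o daddv_pi (U^C)%VS U)%VF.

Definition qsect : 'Hom(quotv, V) := linfun vsval.

Lemma capv_complC : (U^C :&: U = 0)%VS.
Proof. by rewrite capvC capv_compl. Qed.

Lemma qsectK x : qproj (qsect x) = x.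
Proof.
rewrite comp_lfunE !lfunE /= daddv_pi_id ?capv_complC ?subvsP //.
exact: vsvalK.
Qed.

Lemma qproj_full : limg qproj = fullv.
Proof.
apply/eqP; rewrite eqEsubv subvf; apply/subvP=> x _.
by rewrite -[x]qsectK memv_img ?memvf.
Qed.

Lemma qproj_ker : lker qproj = U.
Proof.
apply/vspaceP=> v; rewrite memv_ker comp_lfunE lfunE /=.
have vE : daddv_pi (U^C)%VS U v + daddv_pi U (U^C)%VS v = v.
  by rewrite daddv_pi_add ?capv_complC // addvC addv_complf memvf.
apply/eqP/idP=> [/(congr1 vsval) | Uv].
  by rewrite vsprojK ?memv_pi // raddf0 => v0; rewrite -vE v0 add0r memv_pi.
apply: val_inj; rewrite /= vsprojK ?memv_pi //.
apply/eqP; rewrite -memv0 -capv_complC memv_cap memv_pi /=.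
by rewrite -(addrK (daddv_pi U (U^C)%VS v) (daddv_pi _ _ _)) vE memvB ?memv_pi.
Qed.

End Quotient.

Section QuotientMap.
Variables (k : fieldType) (V V' : vectType k).
Variables (U : {vspace V}) (U' : {vspace V'}).

(* The map V / U -> V' / U' induced by f, meaningful when f(U) <= U'. *)
Definition qmap (f : 'Hom(V, V')) : 'Hom(quotv U, quotv U') :=
  (qproj U' \o f \o qsect U)%VF.

Lemma qmap_proj f v : (f @: U <= U')%VS -> qmap f (qproj U v) = qproj U' (f v).
Proof.
move=> fU; have -> : qmap f (qproj U v) = qproj U' (f (qsect U (qproj U v))).
  by rewrite /qmap !comp_lfunE.
apply/eqP; rewrite -subr_eq0 -linearB -memv_ker qproj_ker -linearB.
apply: (subvP fU); apply: memv_img.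
suff: qsect U (qproj U v) - v \in lker (qproj U) by rewrite qproj_ker.
by rewrite memv_ker linearB /= qsectK subrr.
Qed.

End QuotientMap.

Section BalancedTensor.
Variables (k : fieldType) (R : falgType k).

Section Def.
Variables (M : rmod R) (N : fdmod R).

(* r \otimes (m \otimes n) |-> m r \otimes n - m \otimes r n *)
Definition bdiff : 'Hom(tens R (tens M N), tens M N) :=
  tlift (fun r => (tmap (act M r) \1 - tmap \1 (act N r))%VF).

Definition brel : {vspace tens M N} := limg bdiff.

Definition btens : vectType k := quotv brel.

Definition bpure (m : M) (n : N) : btens := qproj brel (tpure m n).

Lemma bdiff_pure r t :
  bdiff (tpure r t) = tmap (act M r) \1%VF t - tmap \1%VF (act N r) t.
Proof.
have [_ pl] := tmap_bilinear M M N N; have [pr _] := tmap_bilinear M M N N.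
rewrite /bdiff tlift_pure ?add_lfunE ?opp_lfunE //.
split=> [u|u] c x y; first exact: linearP.
rewrite (@act_linear _ _ M) (@act_linear _ _ N) pl pr.
by rewrite !(add_lfunE, opp_lfunE, scale_lfunE) scalerBr addrACA opprD.
Qed.

Lemma bpure_balanced r m n : bpure (act M r m) n = bpure m (act N r n).
Proof.
apply/eqP; rewrite -subr_eq0 -linearB -memv_ker qproj_ker.
have -> : tpure (act M r m) n - tpure m (act N r n) = bdiff (tpure r (tpure m n)).
  by rewrite bdiff_pure !tmap_pure !id_lfunE.
exact/memv_img/memvf.
Qed.

Lemma bpure_bilinear : bilinear_map bpure.
Proof.
have [pr pl] := tpure_bilinear M N.
by split=> [u|u] c x y; rewrite /bpure (pr, pl) linearP.
Qed.

Lemma btens_uniq (U : vectType k) (f g : 'Hom(btens, U)) :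
  (forall m n, f (bpure m n) = g (bpure m n)) -> f = g.
Proof.
move=> fg; have fqE : (f \o qproj brel = g \o qproj brel)%VF.
  by apply: tlift_uniq => m n; rewrite comp_lfunE [RHS]comp_lfunE; exact: fg.
apply/lfunP=> x; rewrite -[x]qsectK.
by have /lfunP/(_ (qsect _ x)) := fqE; rewrite !comp_lfunE.
Qed.

End Def.

Section Map.
Variables (M M' : rmod R) (N N' : fdmod R).
Variables (f : 'Hom(M, M')) (g : 'Hom(N, N')).

Definition bmap : 'Hom(btens M N, btens M' N') :=
  qmap (brel M N) (brel M' N') (tmap f g).

Lemma tmap_brel : modhom f -> modhom g -> (tmap f g @: brel M N <= brel M' N')%VS.
Proof.
move=> f_hom g_hom; rewrite /brel -limg_comp.
have -> : (tmap f g \o bdiff M N = bdiff M' N' \o tmap \1 (tmap f g))%VF.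
  apply/tlift_uniq => r; apply: tens_ind => [m n|c x y IHx IHy]; last first.
    have [pr _] := tpure_bilinear R (tens M N).
    by rewrite pr !linearP /= IHx IHy.
  rewrite !comp_lfunE !(tmap_pure, bdiff_pure, id_lfunE) linearB /=.
  by rewrite !tmap_pure f_hom g_hom.
by rewrite limg_comp limgS ?subvf.
Qed.

Lemma bmap_pure m n : modhom f -> modhom g ->
  bmap (bpure m n) = bpure (f m) (g n).
Proof.
by move=> f_hom g_hom; rewrite qmap_proj ?tmap_brel // tmap_pure.
Qed.

End Map.

End BalancedTensor.

(** * Existence of projective resolutions *)

Section FreeResolution.
Variables (k : fieldType) (R : falgType k).

Section Free.
Variable W : vectType k.

Definition free_act (r : R) : 'End(tens R W) := tmap (amull r) \1.

Lemma free_act_pure r s w : free_act r (tpure s w) = tpure (r * s) w.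
Proof. by rewrite /free_act tmap_pure id_lfunE lfunE. Qed.

Fact free_act_linear : linear free_act.
Proof.
have [_ ml] := tmap_bilinear R R W W.
by move=> c r s; rewrite /free_act linearP ml.
Qed.

Fact free_act1 : free_act 1 = \1%VF.
Proof. by apply: tlift_uniq => r w; rewrite free_act_pure mul1r id_lfunE. Qed.

Fact free_actM (r s : R) : free_act (r * s) = (free_act r \o free_act s)%VF.
Proof.
by apply: tlift_uniq => t w; rewrite comp_lfunE !free_act_pure mulrA.
Qed.

Definition free_mod : fdmod R := FdMod free_act_linear free_act1 free_actM.

Definition free_lift (M : fdmod R) (h : 'Hom(W, M)) : 'Hom(free_mod, M) :=
  tlift (fun r w => act M r (h w)).

Lemma free_lift_pure (M : fdmod R) (h : 'Hom(W, M)) r w :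
  free_lift h (tpure r w) = act M r (h w).
Proof.
rewrite /free_lift tlift_pure //; split=> [u|u] c x y; first by rewrite !linearP.
by rewrite act_linear add_lfunE scale_lfunE.
Qed.

Lemma free_lift_hom (M : fdmod R) (h : 'Hom(W, M)) : modhom (free_lift h).
Proof.
move=> r; apply: tens_ind => [s w|c x y IHx IHy].
  by rewrite [act _ _ _]free_act_pure !free_lift_pure actM comp_lfunE.
by rewrite !linearP /= IHx IHy.
Qed.

Lemma free_mod_projective : projective_mod free_mod.
Proof.
move=> M N p f p_hom f_hom p_surj.
pose i : 'Hom(W, free_mod) := linfun (tpure (1 : R)).
have iE w : i w = tpure 1 w.
  by apply: linfun_linE; have [pr _] := tpure_bilinear R W; exact: pr.
exists (free_lift (p^-1 \o f \o i)%VF); first exact: free_lift_hom.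
apply: tlift_uniq => r w; rewrite comp_lfunE free_lift_pure p_hom.
rewrite !comp_lfunE limg_lfunVK ?p_surj ?memvf // iE -f_hom.
by rewrite [act _ _ _]free_act_pure mulr1.
Qed.

End Free.

Section Kernel.
Variables (M N : fdmod R) (f : 'Hom(M, N)).
Hypothesis f_hom : modhom f.

Definition ker_incl : 'Hom(subvs_of (lker f), M) := linfun vsval.

Definition ker_act (r : R) : 'End(subvs_of (lker f)) :=
  (linfun (vsproj (lker f)) \o act M r \o ker_incl)%VF.

Lemma ker_actE r x : ker_incl (ker_act r x) = act M r (ker_incl x).
Proof.
rewrite /ker_act 2!comp_lfunE /ker_incl !lfunE /= vsprojK //.
by rewrite memv_ker f_hom (eqP (_ : f (vsval x) == 0)) ?linear0 // -memv_ker subvsP.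
Qed.

Lemma ker_incl_inj : injective ker_incl.
Proof. by move=> x y; rewrite !lfunE; apply: val_inj. Qed.

Fact ker_act_linear : linear ker_act.
Proof.
move=> c r s; apply/lfunP=> x; apply: ker_incl_inj.
rewrite add_lfunE scale_lfunE linearP /= !ker_actE act_linear.
by rewrite add_lfunE scale_lfunE.
Qed.

Fact ker_act1 : ker_act 1 = \1%VF.
Proof.
by apply/lfunP=> x; apply: ker_incl_inj; rewrite ker_actE act1 !id_lfunE.
Qed.

Fact ker_actM (r s : R) : ker_act (r * s) = (ker_act r \o ker_act s)%VF.
Proof.
apply/lfunP=> x; apply: ker_incl_inj.
by rewrite comp_lfunE !ker_actE actM comp_lfunE.
Qed.

Definition ker_mod : fdmod R := FdMod ker_act_linear ker_act1 ker_actM.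

Lemma ker_incl_hom : @modhom _ _ ker_mod M ker_incl.
Proof. by move=> r x; rewrite -ker_actE. Qed.

Lemma ker_incl_img : limg ker_incl = lker f.
Proof.
apply/vspaceP=> v; apply/memv_imgP/idP => [[x _ ->]|fv].
  by rewrite lfunE subvsP.
by exists (vsproj _ v); rewrite ?memvf // lfunE /= vsprojK.
Qed.

End Kernel.

Definition cover (X : fdmod R) : 'Hom(free_mod X, X) := free_lift \1%VF.

Lemma cover_hom X : modhom (cover X). Proof. exact: free_lift_hom. Qed.

Lemma cover_surj X : limg (cover X) = fullv.
Proof.
apply/eqP; rewrite eqEsubv subvf; apply/subvP=> x _.
have <- : cover X (tpure 1 x) = x by rewrite free_lift_pure act1 !id_lfunE.
by rewrite memv_img ?memvf.
Qed.

Fixpoint syzygy (X : fdmod R) (n : nat) : fdmod R :=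
  if n is m.+1 then ker_mod (@cover_hom (syzygy X m)) else X.

Lemma proj_resolution_exists (X : fdmod R) :
  exists P d e, @proj_resolution k R X P d e.
Proof.
pose P n := free_mod (syzygy X n).
pose d n : 'Hom(P n.+1, P n) :=
  (ker_incl (cover (syzygy X n)) \o cover (syzygy X n.+1))%VF.
have ker_d n : lker (d n) = lker (cover (syzygy X n.+1)).
  apply/vspaceP=> v; rewrite !memv_ker comp_lfunE.
  by rewrite -[X in _ == X](linear0 (ker_incl (cover (syzygy X n))))
             (inj_eq (@ker_incl_inj _ _ _)).
have img_d n : limg (d n) = lker (cover (syzygy X n)).
  by rewrite limg_comp cover_surj ker_incl_img.
exists P, d, (cover X); split=> [n|n||||n].
- exact: free_mod_projective.
- by move=> r x; rewrite comp_lfunE cover_hom [in RHS]comp_lfunE; 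
  exact: (@ker_incl_hom _ _ _ (@cover_hom (syzygy X n))).
- exact: cover_hom.
- exact: cover_surj.
- exact: img_d.
- by rewrite img_d ker_d.
Qed.

End FreeResolution.

(** * Tor and the monomorphism category *)

(* Tor_i^R(M, X) = 0: the homology of M \otimes_R P in degree i vanishes for the
   projective resolutions P of X. These exist by [proj_resolution_exists], and
   the homology does not depend on P. *)
Definition Tor_eq0 (k : fieldType) (R : falgType k) (M : rmod R) (X : fdmod R)
    (i : nat) : Prop :=
  forall (P : nat -> fdmod R) (d : forall n, 'Hom(P n.+1, P n))
         (e : 'Hom(P 0, X)), proj_resolution d e ->
  let bd n : 'Hom(btens M (P n.+1), btens M (P n)) := bmap \1 (d n) in
  if i is j.+1 then limg (bd j.+1) = lker (bd j) else limg (bd 0) = fullv.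

Section Mon.
Variables (k : fieldType) (A B : falgType k).
Let L : falgType k := talg A B.

Section OuterTensor.
Variable V : rmod B.

(* The right L-module A \otimes V:
   (a' \otimes v) (a \otimes b) = a' a \otimes v b. *)
Definition outer_act (x : L^c) : 'End(tens A V) :=
  tlift (fun (a : A) (b : B) => tmap (amulr a) (act V b)) x.

Lemma outer_act_pure a b a' v :
  outer_act (tpure a b) (tpure a' v) = tpure (a' * a) (act V b v).
Proof.
have [pr pl] := tmap_bilinear A A V V.
rewrite /outer_act tlift_pure; first by rewrite tmap_pure lfunE.
split=> [u|u] c x y; last by rewrite linearP pl.
by rewrite (@act_linear _ _ V) pr.
Qed.

Fact outer_act_linear : linear outer_act.
Proof. by move=> c x y; rewrite /outer_act linearP. Qed.

Fact outer_act1 : outer_act 1 = \1%VF.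
Proof.
by apply: tlift_uniq => a v; rewrite outer_act_pure mulr1 (@act1 _ _ V) !id_lfunE.
Qed.

Fact outer_actM (x y : L^c) :
  outer_act (x * y) = (outer_act x \o outer_act y)%VF.
Proof.
rewrite -[x * y]/(tmull A B y x).
elim/tens_ind: x => [a b|c x x' IHx IHx']; last first.
  rewrite linearP /= !outer_act_linear comp_lfunDl -comp_lfunZl.
  by rewrite IHx IHx'.
elim/tens_ind: y => [a' b'|c y y' IHy IHy']; last first.
  rewrite linearP add_lfunE scale_lfunE !outer_act_linear.
  by rewrite comp_lfunDr -comp_lfunZr IHy IHy'.
apply: tlift_uniq => a'' v; rewrite comp_lfunE tmull_pure !outer_act_pure.
by rewrite mulrA -[in RHS]comp_lfunE -(@actM _ _ V).
Qed.

Definition outer : rmod L := FdMod outer_act_linear outer_act1 outer_actM.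

Variable X : fdmod L.

(* The left A-module (A \otimes V) \otimes_L X. *)
Definition outer_btens_act (a : A) : 'End(btens outer X) :=
  bmap (M := outer) (M' := outer) (tmap (amull a) \1) \1.

Lemma outer_mull_hom a : @modhom _ _ outer outer (tmap (amull a) \1).
Proof.
suff homE x y : tmap (amull a) \1 (outer_act x y)
              = outer_act x (tmap (amull a) \1 y) by exact: homE.
elim/tens_ind: y => [a' v|c y z IHy IHz]; last first.
  by rewrite !linearP /= IHy IHz.
elim/tens_ind: x => [a'' b|c x x' IHx IHx']; last first.
  by rewrite !outer_act_linear !(add_lfunE, scale_lfunE) linearP /= IHx IHx'.
by rewrite !(outer_act_pure, tmap_pure) !id_lfunE !lfunE /= mulrA.
Qed.

Lemma outer_btens_actE a t x :
  outer_btens_act a (bpure (M := outer) t x)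
  = bpure (M := outer) (tmap (amull a) \1%VF t) x.
Proof.
rewrite bmap_pure ?id_lfunE //; first exact: outer_mull_hom.
by move=> r y; rewrite !id_lfunE.
Qed.

Fact outer_btens_act_linear : linear outer_btens_act.
Proof.
have [_ bl] := bpure_bilinear outer X; have [_ ml] := tmap_bilinear A A V V.
move=> c a b; apply: btens_uniq => t x.
rewrite add_lfunE scale_lfunE !outer_btens_actE linearP ml.
by rewrite add_lfunE scale_lfunE bl.
Qed.

Fact outer_btens_act1 : outer_btens_act 1 = \1%VF.
Proof.
apply: btens_uniq => t x; rewrite outer_btens_actE id_lfunE.
suff -> : tmap (amull (1 : A)) \1%VF = \1%VF :> 'End(tens A V).
  by rewrite id_lfunE.
by apply: tlift_uniq => a v; rewrite tmap_pure amull1 !id_lfunE.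
Qed.

Fact outer_btens_actM (a b : A) :
  outer_btens_act (a * b) = (outer_btens_act a \o outer_btens_act b)%VF.
Proof.
apply: btens_uniq => t x; rewrite comp_lfunE !outer_btens_actE.
suff -> : tmap (amull (a * b)) \1%VF
       = (tmap (amull a) \1 \o tmap (amull b) \1)%VF :> 'End(tens A V).
  by rewrite comp_lfunE.
apply: tlift_uniq => a' v; rewrite comp_lfunE !tmap_pure !id_lfunE.
by rewrite !lfunE /= mulrA.
Qed.

Definition outer_btens : fdmod A :=
  FdMod outer_btens_act_linear outer_btens_act1 outer_btens_actM.

End OuterTensor.

Definition Mon (X : fdmod L) : Prop :=
  forall S : fdmod B, simple_mod S ->
  forall i, (1 <= i)%N -> Tor_eq0 (outer (dual S)) X i.

(* Mon(B, C), for a full subcategory C of A-mod given by its objects. *)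
Definition Mon_in (C : fdmod A -> Prop) (X : fdmod L) : Prop :=
  Mon X /\ forall V : rmod B, C (outer_btens V X).

End Mon.

(* Main.v *)
(* For a right B-module V, (A (x) V) (x)_L X is V (x)_B X, and X lies in Mon(B, A)
   exactly when its restriction to B is projective: the Tor condition for simple
   modules dualises to Ext^1_B(X, S) = 0, whence Ext^1_B(X, -) = 0.

   All uses of Ext rest on the adjunction
   Hom_A(V (x)_B X, Y) = Hom_L(X, Hom_k(V, Y)) and on Hom_k(V, A) = A (x) DV.
   - If X is in Mon(B, A-Gproj), then Ext^1_L(X, A (x) W) = 0 for every B-module W,
     so a free approximation X -> P stays a monomorphic approximation after V (x)_B -,
     and its cokernel is in Mon(B, A-Gproj) again: iterating gives a total resolution.
     This inclusion holds for every B.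
   - If B has finite global dimension, the cocycles of a total resolution over L are
     B-projective, so V (x)_B - preserves its exactness, and Hom_A(-, A) does so too
     because A (x) DV has finite projective dimension over L.
   - Conversely A (x) G is Gorenstein projective over L when G is so over B, so the
     equality of the two categories makes every Gorenstein projective B-module
     projective. As B is Gorenstein, high syzygies are Gorenstein projective, hence
     gldim B is finite. *)
Require Import Defs.
From mathcomp Require Import all_boot all_order all_algebra all_field.
From Stdlib Require Import ClassicalEpsilon.

Set Implicit Arguments.
Unset Strict Implicit.
Unset Printing Implicit Defensive.

Import GRing.Theory VectorInternalTheory.
Local Open Scope ring_scope.
Local Notation cover := Defs.cover.

(** * Short exact sequences and extension problems *)

(** No Ext group is constructed: Ext^1(Z, Y) = 0 means that maps to Y extend along the kernel of a
    projective presentation of Z, and independence of the presentation is Schanuel's lemma, up to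
    stable retracts.

    For Mon(B, A-Gproj) the obstacle is the step to the right. A left approximation X -> P only
    controls maps into projective L-modules, whereas after V (x)_B - the question concerns maps X ->
    A (x) DV. Such a map lifts to A (x) F, with F a free cover of DV, since Ext^1_L(X, A (x)
    Omega(DV)) = 0; then the approximation applies. The choice V = DX settles two problems at once:
    as D(DX (x)_B X) = End_B(X), injectivity of DX (x)_B X -> DX (x)_B P yields a B-linear
    retraction of X -> P, so X -> P is injective with B-projective cokernel.

    If gldim B is finite, a cocycle is B-projective because it is a syzygy of arbitrarily high
    order. For the converse, a linear form on A with value 1 at 1 makes G a direct summand of A (x)
    G over B. *)

Section LinearMaps.
Variables (k : fieldType) (U V W : vectType k).

Lemma lker_eq0P (f : 'Hom(U, V)) : lker f = 0%VS <-> forall x, f x = 0 -> x = 0.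
Proof.
split=> [/eqP/lker0P f_inj x fx0 | f_inj]; first by apply: f_inj; rewrite fx0 linear0.
apply/eqP/lker0P=> x y fxy; apply/eqP; rewrite -subr_eq0; apply/eqP/f_inj.
by rewrite linearB /= fxy subrr.
Qed.

Lemma limg_fullP (f : 'Hom(U, V)) : limg f = fullv <-> forall y, exists x, f x = y.
Proof.
split=> [f_surj y | f_surj]; last first.
  by apply/vspaceP=> y; rewrite memvf; have [x <-] := f_surj y; rewrite memv_img ?memvf.
by have /memv_imgP[x _ ->] : y \in limg f; [rewrite f_surj memvf | exists x].
Qed.

Lemma limg_lkerP (f : 'Hom(U, V)) (g : 'Hom(V, W)) :
  limg f = lker g <->
    (forall x, g (f x) = 0) /\ (forall y, g y = 0 -> exists x, y = f x).
Proof.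
split=> [fg | [gf0 ex]].
  split=> [x | y gy0]; first by apply/eqP; rewrite -memv_ker -fg memv_img ?memvf.
  by have /memv_imgP[x _ ->] : y \in limg f; [rewrite fg memv_ker gy0 | exists x].
apply/vspaceP=> y; rewrite memv_ker; apply/memv_imgP/eqP => [[x _ ->] // | /ex[x ->]].
by exists x; rewrite ?memvf.
Qed.

Lemma limg_lfunV (f : 'Hom(U, V)) y : (exists x, f x = y) -> f (f^-1%VF y) = y.
Proof. by case=> x <-; rewrite limg_lfunVK ?memv_img ?memvf. Qed.

Lemma lfunV_inj (f : 'Hom(U, V)) x :
  (forall x, f x = 0 -> x = 0) -> f^-1%VF (f x) = x.
Proof. by move/lker_eq0P/eqP/lker0_lfunK. Qed.

End LinearMaps.

Section ModuleMaps.
Variables (k : fieldType) (R : falgType k).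
Implicit Types C E G I K L M N P Q X Y Z : fdmod R.

Lemma act1E M x : act M 1 x = x.
Proof. by rewrite act1 id_lfunE. Qed.

Lemma actME M r s x : act M (r * s) x = act M r (act M s x).
Proof. by rewrite actM comp_lfunE. Qed.

Lemma modhom_id M : @modhom k R M M \1%VF.
Proof. by move=> r x; rewrite !id_lfunE. Qed.

Lemma modhom_comp M N P (f : 'Hom(M, N)) (g : 'Hom(N, P)) :
  modhom f -> modhom g -> @modhom k R M P (g \o f)%VF.
Proof. by move=> f_hom g_hom r x; rewrite !comp_lfunE f_hom g_hom. Qed.

Lemma modhomD M N (f g : 'Hom(M, N)) :
  @modhom k R M N f -> @modhom k R M N g -> @modhom k R M N (f + g).
Proof. by move=> f_hom g_hom r x; rewrite !add_lfunE f_hom g_hom linearD. Qed.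

Lemma modhomN M N (f : 'Hom(M, N)) : @modhom k R M N f -> @modhom k R M N (- f).
Proof. by move=> f_hom r x; rewrite !opp_lfunE f_hom linearN. Qed.

Lemma modhomB M N (f g : 'Hom(M, N)) :
  @modhom k R M N f -> @modhom k R M N g -> @modhom k R M N (f - g).
Proof. by move=> f_hom g_hom; apply/modhomD/modhomN. Qed.

Lemma modhom0 M N : @modhom k R M N 0.
Proof. by move=> r x; rewrite !zero_lfunE linear0. Qed.

(** The linear pseudo-inverse [p^-1] need not be a module map, but f \o p^-1 is one because f kills
    Ker p. *)
Lemma factor_surj M N Y (p : 'Hom(M, N)) (f : 'Hom(M, Y)) :
    modhom p -> modhom f -> (forall z, exists y, p y = z) ->
    (forall x, p x = 0 -> f x = 0) ->
  exists2 g : 'Hom(N, Y), modhom g & forall x, g (p x) = f x.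
Proof.
move=> p_hom f_hom p_surj pf.
have gE x : (f \o p^-1)%VF (p x) = f x.
  rewrite comp_lfunE; apply/eqP; rewrite -subr_eq0 -linearB; apply/eqP/pf.
  by rewrite linearB /= limg_lfunV ?subrr //; exists x.
exists (f \o p^-1)%VF => // r z; have [y <-] := p_surj z.
by rewrite -p_hom !gE f_hom.
Qed.

Lemma factor_inj K M Y (i : 'Hom(K, M)) (f : 'Hom(Y, M)) :
    modhom i -> modhom f -> (forall x, i x = 0 -> x = 0) ->
    (forall y, exists x, f y = i x) ->
  exists2 g : 'Hom(Y, K), modhom g & forall y, i (g y) = f y.
Proof.
move=> i_hom f_hom i_inj fi.
have gE y : i ((i^-1 \o f)%VF y) = f y.
  by rewrite comp_lfunE limg_lfunV //; have [x ->] := fi y; exists x.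
exists (i^-1 \o f)%VF => // r y; apply/eqP; rewrite -subr_eq0; apply/eqP/i_inj.
by rewrite linearB /= gE i_hom gE f_hom subrr.
Qed.

Lemma proj_lift P M N (p : 'Hom(M, N)) (f : 'Hom(P, N)) :
    projective_mod P -> modhom p -> modhom f -> (forall y, exists x, p x = y) ->
  exists2 g : 'Hom(P, M), modhom g & forall x, p (g x) = f x.
Proof.
move=> P_proj p_hom f_hom /limg_fullP p_surj.
by have [g g_hom <-] := P_proj _ _ p f p_hom f_hom p_surj; exists g => // x; rewrite comp_lfunE.
Qed.

Lemma projI P :
    (forall M N (p : 'Hom(M, N)) (f : 'Hom(P, N)), modhom p -> modhom f ->
      (forall y, exists x, p x = y) ->
      exists2 g : 'Hom(P, M), modhom g & forall x, p (g x) = f x) ->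
  projective_mod P.
Proof.
move=> lift M N p f p_hom f_hom /limg_fullP p_surj.
have [g g_hom pg] := lift _ _ _ _ p_hom f_hom p_surj; exists g => //.
by apply/lfunP=> x; rewrite comp_lfunE.
Qed.

Lemma proj_retract P X (s : 'Hom(X, P)) (r : 'Hom(P, X)) :
    projective_mod P -> modhom s -> modhom r -> (forall x, r (s x) = x) ->
  projective_mod X.
Proof.
move=> P_proj s_hom r_hom rs; apply: projI => M N p f p_hom f_hom p_surj.
have [g g_hom pg] := proj_lift P_proj p_hom (modhom_comp r_hom f_hom) p_surj.
exists (g \o s)%VF; first exact: modhom_comp.
by move=> x; rewrite comp_lfunE pg comp_lfunE rs.
Qed.

Record ses X Y Z (i : 'Hom(X, Y)) (p : 'Hom(Y, Z)) : Prop := Ses {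
  ses_i : modhom i;
  ses_p : modhom p;
  ses_inj : forall x, i x = 0 -> x = 0;
  ses_pi : forall x, p (i x) = 0;
  ses_ex : forall y, p y = 0 -> exists x, y = i x;
  ses_sur : forall z, exists y, p y = z
}.

Lemma ses_ker M N (p : 'Hom(M, N)) (p_hom : modhom p) :
  (forall z, exists y, p y = z) -> @ses (ker_mod p_hom) M N (ker_incl p) p.
Proof.
have [pi ex] := (limg_lkerP _ _).1 (ker_incl_img p).
split=> //; first exact: ker_incl_hom.
by move=> x ix0; apply: (@ker_incl_inj _ _ _ _ p); rewrite ix0 linear0.
Qed.

Lemma cover_onto M (z : M) : exists y, cover M y = z.
Proof. exact: (limg_fullP _).1 (cover_surj M) z. Qed.

Lemma ses_syz X : ses (ker_incl (cover X) : 'Hom(syzygy X 1, _)) (cover X).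
Proof. exact/ses_ker/cover_onto. Qed.

Section QuotientModule.
Variables (M : fdmod R) (U : {vspace M}).
Hypothesis U_stable : forall r x, x \in U -> act M r x \in U.

Definition quot_act (r : R) : 'End(quotv U) := qmap U U (act M r).

Lemma quot_actE r x : quot_act r (qproj U x) = qproj U (act M r x).
Proof.
by apply: qmap_proj; apply/subvP=> _ /memv_imgP[y Uy ->]; apply: U_stable.
Qed.

Fact quot_act_linear : linear quot_act.
Proof.
move=> c r s; apply/lfunP=> x; rewrite -[x]qsectK add_lfunE scale_lfunE !quot_actE.
by rewrite act_linear add_lfunE scale_lfunE linearP.
Qed.

Fact quot_act1 : quot_act 1 = \1%VF.
Proof. by apply/lfunP=> x; rewrite -[x]qsectK quot_actE act1 !id_lfunE. Qed.

Fact quot_actM r s : quot_act (r * s) = (quot_act r \o quot_act s)%VF.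
Proof.
by apply/lfunP=> x; rewrite -[x]qsectK comp_lfunE !quot_actE actM comp_lfunE.
Qed.

Definition quot_mod : fdmod R := FdMod quot_act_linear quot_act1 quot_actM.

Lemma qproj_hom : @modhom k R M quot_mod (qproj U).
Proof. by move=> r x; rewrite -quot_actE. Qed.

Lemma qproj_onto (z : quot_mod) : exists y, qproj U y = z.
Proof. by exists (qsect U z); rewrite qsectK. Qed.

Lemma qproj_eq0 x : (qproj U x = 0) <-> x \in U.
Proof.
have -> : (x \in U) = (qproj U x == 0) by rewrite -memv_ker qproj_ker.
by split=> [->|/eqP]. Qed.

End QuotientModule.

Lemma ses_coker X Y (i : 'Hom(X, Y)) : modhom i -> (forall x, i x = 0 -> x = 0) ->
  exists (Z : fdmod R) (p : 'Hom(Y, Z)), ses i p.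
Proof.
move=> i_hom i_inj.
have stable r y : y \in limg i -> act Y r y \in limg i.
  by case/memv_imgP=> x _ ->; rewrite -i_hom memv_img ?memvf.
exists (quot_mod stable), (qproj (limg i)); split=> //.
- exact: qproj_hom.
- by move=> x; apply/qproj_eq0/memv_img/memvf.
- by move=> y /qproj_eq0/memv_imgP[x _ ->]; exists x.
- exact: qproj_onto.
Qed.

(** Used in two roles: along the kernel of a projective presentation it expresses the vanishing of
    Ext^1, and along a map to a projective module, with Y = R, it says that i is a left
    approximation by projectives. *)
Definition extends K Q (i : 'Hom(K, Q)) Y : Prop :=
  forall f : 'Hom(K, Y), modhom f ->
  exists2 g : 'Hom(Q, Y), modhom g & forall x, g (i x) = f x.

(* Ext^1(Z, Y) = 0 *)
Definition Ext1_eq0 Z Y : Prop :=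
  forall K Q (i : 'Hom(K, Q)) (p : 'Hom(Q, Z)),
  projective_mod Q -> ses i p -> extends i Y.

(** Exactness of Hom(K, E) -> Hom(K, Y) -> Ext^1(K, Y'). A lift of f to the free cover of K sends
    the syzygy into Y'; extending that restriction to the cover and subtracting it makes the lift
    descend to K. *)
Lemma ext1_lift K Y (Y' : fdmod R) E (i : 'Hom(Y', E)) (p : 'Hom(E, Y)) (f : 'Hom(K, Y)) :
    Ext1_eq0 K Y' -> ses i p -> modhom f ->
  exists2 g : 'Hom(K, E), modhom g & forall x, p (g x) = f x.
Proof.
move=> ext E_ses f_hom; have F_proj := @free_mod_projective k R K.
have K_ses := ses_syz K; set j := ker_incl (cover K) in K_ses.
have [ih ph inj pi ex sur] := E_ses.
have [jh ch jinj cj cex csur] := K_ses.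
have [h h_hom hE] := proj_lift F_proj ph (modhom_comp ch f_hom) sur.
have hj_hom := modhom_comp jh h_hom.
have [x|u u_hom uE] := factor_inj ih hj_hom inj.
  by apply: ex; rewrite comp_lfunE hE comp_lfunE cj linear0.
have [v v_hom vE] := ext _ _ _ _ F_proj K_ses u u_hom.
have [x cx0|g g_hom gE] :=
  factor_surj ch (modhomB h_hom (modhom_comp v_hom ih)) csur.
  have [y ->] := cex x cx0; rewrite add_lfunE opp_lfunE comp_lfunE vE uE.
  by rewrite comp_lfunE subrr.
exists g => // x; have [y <-] := csur x.
by rewrite gE add_lfunE opp_lfunE comp_lfunE linearB /= pi subr0 hE comp_lfunE.
Qed.

(* C is a direct summand of the direct sum of G and a projective module. *)
Definition stab C G : Prop :=
  exists P0 (s : 'Hom(C, G)) (r : 'Hom(G, C)) (v : 'Hom(C, P0)) (u : 'Hom(P0, C)),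
  [/\ projective_mod P0, [/\ modhom s, modhom r, modhom v & modhom u]
    & forall x, x = r (s x) + u (v x)].

Lemma stab_iso C G (s : 'Hom(C, G)) (r : 'Hom(G, C)) :
  modhom s -> modhom r -> (forall x, r (s x) = x) -> stab C G.
Proof.
move=> s_hom r_hom rs; exists (free_mod R C), s, r, 0, 0.
split; first exact: free_mod_projective; first by split=> //; exact: modhom0.
by move=> x; rewrite rs zero_lfunE addr0.
Qed.

Lemma stab_refl C : stab C C.
Proof.
by apply: stab_iso; [exact: modhom_id | exact: modhom_id |]; move=> x; rewrite !id_lfunE.
Qed.

(* Schanuel's lemma, for the relation [stab]; the clause
   S \o i = j \o s lets extension problems along i be solved along j. *)
Lemma stab_syz_data C G K Q L P (i : 'Hom(K, Q)) (p : 'Hom(Q, C))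
    (j : 'Hom(L, P)) (q : 'Hom(P, G)) :
    stab C G -> ses i p -> ses j q -> projective_mod Q -> projective_mod P ->
  exists (S : 'Hom(Q, P)) (s : 'Hom(K, L)) (r : 'Hom(L, K)) (w : 'Hom(Q, K)),
  [/\ modhom S, [/\ modhom s, modhom r & modhom w],
      forall x, S (i x) = j (s x) & forall x, x = r (s x) + w (i x)].
Proof.
case=> P0 [s [r [v [u [P0_proj [s_hom r_hom v_hom u_hom] rsuv]]]]].
case=> ih ph iinj pi iex psur [jh qh jinj qj jex qsur] Q_proj P_proj.
have [S S_hom SE] := proj_lift Q_proj qh (modhom_comp ph s_hom) qsur.
have [T T_hom TE] := proj_lift P_proj ph (modhom_comp qh r_hom) psur.
have [u' u'_hom u'E] := proj_lift P0_proj ph u_hom psur.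
have [x|s' s'_hom s'E] := factor_inj jh (modhom_comp ih S_hom) jinj.
  by apply: jex; rewrite comp_lfunE SE comp_lfunE pi linear0.
have [x|r' r'_hom r'E] := factor_inj ih (modhom_comp jh T_hom) iinj.
  by apply: iex; rewrite comp_lfunE TE comp_lfunE qj linear0.
(* Since r s + u v = 1 on C, this endomorphism of Q lands in Ker p, so it equals i w. Restricted to
   K it reads i - i r' s', which is the required decomposition of the identity of K. *)
pose h : 'Hom(Q, Q) := (\1 - (T \o S) - (u' \o (v \o p)))%VF.
have hE x : h x = x - T (S x) - u' (v (p x)).
  by rewrite !(add_lfunE, opp_lfunE, comp_lfunE, id_lfunE).
have h_hom : modhom h.
  apply: modhomB; first by apply: modhomB; [exact: modhom_id | exact: modhom_comp].
  exact/modhom_comp/u'_hom/modhom_comp.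
have [x|w w_hom wE] := factor_inj ih h_hom iinj.
  apply: iex; rewrite hE !linearB /= TE u'E comp_lfunE SE comp_lfunE.
  by rewrite -addrA -opprD -rsuv subrr.
exists S, s', r', w; split=> // x; first by rewrite s'E comp_lfunE.
apply/eqP; rewrite eq_sym -subr_eq0; apply/eqP/iinj.
rewrite linearB linearD /= wE hE r'E comp_lfunE s'E comp_lfunE pi !linear0 addr0.
by rewrite [X in X - _]addrC subrK subrr.
Qed.

Lemma stab_syz C G K Q L P (i : 'Hom(K, Q)) (p : 'Hom(Q, C))
    (j : 'Hom(L, P)) (q : 'Hom(P, G)) :
    stab C G -> ses i p -> ses j q -> projective_mod Q -> projective_mod P ->
  stab K L.
Proof.
move=> CG Cs Gs Q_proj P_proj.
have [S [s [r [w [S_hom [sh rh wh] _ rswi]]]]] := stab_syz_data CG Cs Gs Q_proj P_proj.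
by exists Q, s, r, i, w; split=> //; split=> //; exact: ses_i Cs.
Qed.

(** Write f = (f r) s + (f w) i: the first summand extends because f r extends along j and S i = j
    s, the second is visibly defined on Q. *)
Lemma extends_stab C G K Q L P (i : 'Hom(K, Q)) (p : 'Hom(Q, C))
    (j : 'Hom(L, P)) (q : 'Hom(P, G)) Y :
    stab C G -> ses i p -> ses j q -> projective_mod Q -> projective_mod P ->
  extends j Y -> extends i Y.
Proof.
move=> CG Cs Gs Q_proj P_proj ext f f_hom.
have [S [s [r [w [S_hom [sh rh wh] SE rswi]]]]] := stab_syz_data CG Cs Gs Q_proj P_proj.
have [g g_hom gE] := ext (f \o r)%VF (modhom_comp rh f_hom).
exists ((g \o S) + (f \o w))%VF; first by apply: modhomD; exact: modhom_comp.
by move=> x; rewrite add_lfunE !comp_lfunE SE gE comp_lfunE -linearD -rswi.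
Qed.

Lemma ext1_stab C G Y : stab C G -> Ext1_eq0 G Y -> Ext1_eq0 C Y.
Proof.
move=> CG ext K Q i p Q_proj C_ses.
apply: (extends_stab CG C_ses (ses_syz G)) => //; first exact: free_mod_projective.
exact: ext (@free_mod_projective k R _) (ses_syz G).
Qed.

(** One presentation decides for all of them, by Schanuel's lemma for [stab_refl]. *)
Lemma ext1_of_ses Z Y K Q (i : 'Hom(K, Q)) (p : 'Hom(Q, Z)) :
  projective_mod Q -> ses i p -> extends i Y -> Ext1_eq0 Z Y.
Proof.
move=> Q_proj Z_ses ext K' Q' i' p' Q'_proj Z_ses'.
exact: extends_stab (stab_refl Z) Z_ses' Z_ses Q'_proj Q_proj ext.
Qed.

Lemma extends_retract K Q (i : 'Hom(K, Q)) Y (Y' : fdmod R) (s : 'Hom(Y, Y')) (r : 'Hom(Y', Y)) :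
    modhom s -> modhom r -> (forall x, r (s x) = x) ->
  extends i Y' -> extends i Y.
Proof.
move=> s_hom r_hom rs ext f f_hom.
have [g g_hom gE] := ext _ (modhom_comp f_hom s_hom).
exists (r \o g)%VF; first exact: modhom_comp.
by move=> x; rewrite comp_lfunE gE comp_lfunE rs.
Qed.

Lemma ext1_retract Z Y (Y' : fdmod R) (s : 'Hom(Y, Y')) (r : 'Hom(Y', Y)) :
    modhom s -> modhom r -> (forall x, r (s x) = x) ->
  Ext1_eq0 Z Y' -> Ext1_eq0 Z Y.
Proof.
move=> s_hom r_hom rs ext K Q i p Q_proj Z_ses.
exact: extends_retract rs (ext _ _ _ _ Q_proj Z_ses).
Qed.

Lemma proj_cover_retract P : projective_mod P ->
  exists2 s : 'Hom(P, free_mod R P), modhom s & forall x, cover P (s x) = x.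
Proof.
move=> P_proj.
have [s s_hom sE] := proj_lift P_proj (@cover_hom _ _ P) (@modhom_id P) (@cover_onto P).
by exists s => // x; rewrite sE id_lfunE.
Qed.

(** Dimension shift in both variables. As Ext^1(K, I) = 0, the obstruction to extending f comes from
    a map h : K -> Y'. It extends to Q since Ext^1(Z, Y') = 0, and then lifts to I since Q is
    projective; subtracting this lift moves the extension of f from I back into Y. *)
Lemma ext1_syz Z Y I (Y' : fdmod R) K Q (i : 'Hom(K, Q)) (p : 'Hom(Q, Z))
    (j : 'Hom(Y, I)) (q : 'Hom(I, Y')) :
    projective_mod Q -> ses i p -> ses j q ->
  Ext1_eq0 K I -> Ext1_eq0 Z Y' -> Ext1_eq0 K Y.
Proof.
move=> Q_proj Zs Ys KI ZY'; have [jh qh jinj qj jex qsur] := Ys.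
have [ih ph iinj pi iex psur] := Zs.
apply: (ext1_of_ses (@free_mod_projective k R _) (ses_syz K)) => f f_hom.
set c := cover K; set l := ker_incl c.
have [lh ch linj cl lex csur] := ses_syz K.
have [g g_hom gE] := KI _ _ _ _ (@free_mod_projective k R _) (ses_syz K) _ (modhom_comp f_hom jh).
have [x cx0|h h_hom hE] := factor_surj ch (modhom_comp g_hom qh) csur.
  by have [y ->] := lex x cx0; rewrite comp_lfunE gE comp_lfunE qj.
have [h' h'_hom h'E] := ZY' _ _ _ _ Q_proj Zs h h_hom.
have [m m_hom mE] := proj_lift Q_proj qh h'_hom qsur.
have gm_hom := modhomB g_hom (modhom_comp (modhom_comp ch ih) m_hom).
have [x|e e_hom eE] := factor_inj jh gm_hom jinj.
  apply: jex; rewrite add_lfunE opp_lfunE !comp_lfunE linearB /= mE h'E hE.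
  by rewrite comp_lfunE subrr.
exists e => // x; apply/eqP; rewrite -subr_eq0; apply/eqP/jinj.
rewrite linearB /= eE add_lfunE opp_lfunE gE !comp_lfunE cl !linear0.
by rewrite addr0 subrr.
Qed.

Lemma ses_split X Y Z (i : 'Hom(X, Y)) (p : 'Hom(Y, Z)) :
    ses i p -> projective_mod Z ->
  exists (s : 'Hom(Z, Y)) (r : 'Hom(Y, X)), [/\ modhom s, modhom r,
    forall z, p (s z) = z, forall x, r (i x) = x & forall y, y = i (r y) + s (p y)].
Proof.
case=> ih ph iinj pi iex psur Z_proj.
have [s s_hom sE] := proj_lift Z_proj ph (@modhom_id Z) psur.
have [y|r r_hom rE] := factor_inj ih (modhomB (@modhom_id Y) (modhom_comp ph s_hom)) iinj.
  by apply: iex; rewrite add_lfunE opp_lfunE comp_lfunE linearB /= sE !id_lfunE subrr.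
have {}rE y : i (r y) = y - s (p y).
  by rewrite rE add_lfunE opp_lfunE comp_lfunE id_lfunE.
exists s, r; split=> // [z|x|y]; first by rewrite sE id_lfunE.
  apply/eqP; rewrite -subr_eq0; apply/eqP/iinj.
  by rewrite linearB /= rE pi linear0 subr0 subrr.
by rewrite rE subrK.
Qed.

Lemma ses_proj_ker X Y Z (i : 'Hom(X, Y)) (p : 'Hom(Y, Z)) :
  ses i p -> projective_mod Z -> projective_mod Y -> projective_mod X.
Proof.
move=> S Z_proj Y_proj; have [s [r [s_hom r_hom _ rE _]]] := ses_split S Z_proj.
exact: proj_retract Y_proj (ses_i S) r_hom rE.
Qed.

Lemma ses_proj_coker X Y Z (i : 'Hom(X, Y))
    (p : 'Hom(Y, Z)) (r : 'Hom(Y, X)) :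
    ses i p -> modhom r -> (forall x, r (i x) = x) -> projective_mod Y ->
  projective_mod Z.
Proof.
move=> S r_hom rE Y_proj; have [ih ph iinj pi iex psur] := S.
have [x /iex[z ->]|s s_hom sE] :=
    factor_surj ph (modhomB (@modhom_id Y) (modhom_comp r_hom ih)) psur.
  by rewrite add_lfunE opp_lfunE comp_lfunE id_lfunE rE subrr.
apply: (proj_retract Y_proj s_hom ph) => z; have [y <-] := psur z.
by rewrite sE add_lfunE opp_lfunE comp_lfunE id_lfunE linearB /= pi subr0.
Qed.

End ModuleMaps.

(** * Free approximations and homological dimensions *)

Section Approximation.
Variables (k : fieldType) (R : falgType k).
Implicit Types C E G I K L M N P Q X Y Z : fdmod R.

Definition act_map M : 'Hom(tens R M, M) := tlift (fun r x => act M r x).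

Lemma act_map_pure M r x : act_map M (tpure r x) = act M r x.
Proof.
rewrite /act_map tlift_pure //; split=> [u|u] c y z; first exact: linearP.
by rewrite act_linear add_lfunE scale_lfunE.
Qed.

(** The map r (x) x |-> f (r x) - r f (x). It is linear in f and vanishes exactly when f is a module
    map, which makes Hom_R(M, N) a subspace with a finite basis, as [free_approx] needs. *)
Definition hom_defect M N (f : 'Hom(M, N)) : 'Hom(tens R M, N) :=
  ((f \o act_map M) - (act_map N \o tmap \1 f))%VF.

Lemma hom_defect_linear M N : linear (@hom_defect M N).
Proof.
have [mr _] := tmap_bilinear R R M N.
move=> c f g; rewrite /hom_defect comp_lfunDl -comp_lfunZl mr comp_lfunDr -comp_lfunZr.
by rewrite scalerBr opprD addrACA.
Qed.

Definition hom_space M N : {vspace 'Hom(M, N)} := lker (linfun (@hom_defect M N)).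

Lemma hom_spaceP M N (f : 'Hom(M, N)) : f \in hom_space M N <-> modhom f.
Proof.
rewrite memv_ker linfun_linE; last exact: hom_defect_linear.
split=> [/eqP f0 r x | f_hom].
  have /lfunP/(_ (tpure r x)) := f0.
  rewrite add_lfunE opp_lfunE !comp_lfunE tmap_pure !act_map_pure id_lfunE zero_lfunE.
  by move/eqP; rewrite subr_eq0 => /eqP.
apply/eqP/tlift_uniq=> r x.
rewrite add_lfunE opp_lfunE !comp_lfunE tmap_pure !act_map_pure id_lfunE zero_lfunE.
by rewrite f_hom subrr.
Qed.

Lemma modhom_sum M N (I : finType) (f : I -> 'Hom(M, N)) :
  (forall i, modhom (f i)) -> @modhom k R M N (\sum_i f i).
Proof.
by move=> f_hom; apply/hom_spaceP/memv_suml => i _; apply/hom_spaceP/f_hom.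
Qed.

Lemma regmod_actE r x : act (regmod R) r x = r * x.
Proof. by rewrite lfunE. Qed.

Section FreeCoordinates.
Variable W : vectType k.

Definition free_coord (j : 'I_(dim W)) : 'Hom(free_mod R W, regmod R) :=
  free_lift (M := regmod R) (linfun (fun w : W => v2r w 0 j *: (1 : R))).

Definition free_gen (w : W) : 'Hom(regmod R, free_mod R W) :=
  linfun (fun r : R => tpure r w).

Lemma free_genE w r : free_gen w r = tpure r w.
Proof. by apply: linfun_linE; have [_ pl] := tpure_bilinear R W; apply: pl. Qed.

Lemma free_gen_hom w : @modhom k R (regmod R) (free_mod R W) (free_gen w).
Proof. by move=> r x; rewrite !free_genE [RHS]free_act_pure lfunE. Qed.

Lemma free_coord_pure j r w : free_coord j (tpure r w) = v2r w 0 j *: r.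
Proof.
pose h (w : W) := v2r w 0 j *: (1 : R).
have h_lin : linear h by move=> c x y; rewrite /h linearP !mxE scalerDl scalerA.
by rewrite free_lift_pure (linfun_linE h_lin) regmod_actE -scalerAr mulr1.
Qed.

Lemma free_coordE x : x = \sum_j free_gen (tbase j) (free_coord j x).
Proof.
elim/tens_ind: x => [r w | c x y IHx IHy]; last first.
  rewrite {1}IHx {1}IHy scaler_sumr -big_split /=; apply: eq_bigr => j _.
  by rewrite !linearP.
have [pr pl] := tpure_bilinear R W.
rewrite {1}[w]tbase_expand (linear_comb (pr r)); apply: eq_bigr => j _.
by rewrite free_coord_pure linearZ /= free_genE.
Qed.

End FreeCoordinates.

Lemma extends_free K Q (i : 'Hom(K, Q)) W :
  extends i (regmod R) -> extends i (free_mod R W).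
Proof.
move=> ext f f_hom.
have f_coord j : modhom (free_coord (W := W) j \o f)%VF.
  by apply: modhom_comp => //; apply: free_lift_hom.
have ext_j j : exists g : 'Hom(Q, regmod R),
    modhom g /\ forall x, g (i x) = free_coord j (f x).
  by have [g g_hom gE] := ext _ (f_coord j); exists g; split=> // x; rewrite gE comp_lfunE.
have [g gP] := fin_all_exists ext_j.
exists (\sum_j (free_gen (tbase j) \o g j)%VF).
  by apply: modhom_sum => j; apply: modhom_comp (gP j).1 (free_gen_hom _).
move=> x; rewrite [RHS]free_coordE sum_lfunE; apply: eq_bigr => j _.
by rewrite comp_lfunE (gP j).2.
Qed.

Lemma extends_proj K Q (i : 'Hom(K, Q)) Y :
  extends i (regmod R) -> projective_mod Y -> extends i Y.
Proof.
move=> ext /proj_cover_retract[s s_hom sK].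
by apply: (extends_retract s_hom (@cover_hom _ _ Y) sK); apply: extends_free.
Qed.

Lemma ext1_proj Z Y : Ext1_eq0 Z (regmod R) -> projective_mod Y -> Ext1_eq0 Z Y.
Proof.
by move=> ext Y_proj K Q i p Q_proj Z_ses; apply: extends_proj Y_proj; apply: ext Z_ses.
Qed.

(** The components of X -> R^n are a k-basis of Hom_R(X, R), so every map X -> R is a combination of
    them. Injectivity is a separate matter and depends on X. *)
Lemma free_approx X : exists P (i : 'Hom(X, P)),
  [/\ projective_mod P, modhom i & extends i (regmod R)].
Proof.
set E := hom_space X (regmod R); pose n := \dim E; pose e := vbasis E.
pose P := free_mod R 'rV[k]_n.
exists P, (\sum_(j < n) (free_gen (delta_mx 0 j) \o e`_j)%VF).
have e_hom j : (j < n)%N -> @modhom k R X (regmod R) e`_j.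
  by move=> jn; apply/hom_spaceP/vbasis_mem/mem_nth; rewrite size_tuple.
split; first exact: free_mod_projective.
  by apply: modhom_sum => j; apply: (modhom_comp (e_hom j (ltn_ord j))); exact: free_gen_hom.
move=> f /hom_spaceP/coord_vbasis fE.
pose h0 (w : 'rV[k]_n) : R := \sum_(j < n) w 0 j *: (coord e j f *: 1).
have h_lin : linear h0.
  move=> c x y; rewrite /h0 scaler_sumr -big_split /=; apply: eq_bigr => j _.
  by rewrite !mxE scalerDl -!scalerA.
pose h : 'Hom('rV[k]_n, regmod R) := linfun h0.
have hE w : h w = h0 w by exact: (linfun_linE h_lin).
have gE r w : free_lift h (tpure r w) = r * h0 w by rewrite free_lift_pure hE regmod_actE.
exists (free_lift h); first exact: free_lift_hom.
move=> x; rewrite [in RHS]fE !sum_lfunE linear_sum; apply: eq_bigr => j _.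
rewrite comp_lfunE free_genE; apply: etrans (gE _ _) _; rewrite /h0 (bigD1 j) //= big1 ?addr0 => [|l jl].
  by rewrite mxE !eqxx scale1r -scalerAr mulr1 scale_lfunE.
by rewrite mxE (negPf jl) andbF scale0r.
Qed.

End Approximation.

(** * Projective and injective dimension, and vanishing of higher Ext *)

Section Dimension.
Variables (k : fieldType) (R : falgType k).
Implicit Types C E G I K L M N P Q X Y Z : fdmod R.

Lemma ses_isoR X Y Z Z' (i : 'Hom(X, Y)) (p : 'Hom(Y, Z))
    (s : 'Hom(Z, Z')) (r : 'Hom(Z', Z)) :
    modhom s -> cancel s r -> cancel r s ->
  ses i p -> @ses k R X Y Z' i (s \o p)%VF.
Proof.
move=> s_hom sK rK [ih ph iinj pi iex psur]; split=> //.
- exact: modhom_comp.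
- by move=> x; rewrite comp_lfunE pi linear0.
- by move=> y; rewrite comp_lfunE => spy; apply: iex; rewrite -[p y]sK spy linear0.
- by move=> z; have [y py] := psur (r z); exists y; rewrite comp_lfunE py rK.
Qed.

Lemma ses_isoL X X' Y Z (i : 'Hom(X, Y)) (p : 'Hom(Y, Z))
    (s : 'Hom(X', X)) (r : 'Hom(X, X')) :
    modhom s -> cancel s r -> cancel r s ->
  ses i p -> @ses k R X' Y Z (i \o s)%VF p.
Proof.
move=> s_hom sK rK [ih ph iinj pi iex psur]; split=> //.
- exact: modhom_comp.
- by move=> x; rewrite comp_lfunE => /iinj sx0; rewrite -[x]sK sx0 linear0.
- by move=> x; rewrite comp_lfunE pi.
- by move=> y /iex[x ->]; exists (r x); rewrite comp_lfunE rK.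
Qed.

Lemma stab_proj C G : stab C G -> projective_mod G -> projective_mod C.
Proof.
case=> P0 [s [r [v [u [P0_proj [s_hom r_hom v_hom u_hom] rsuv]]]]] G_proj.
apply: projI => M N p f p_hom f_hom p_sur.
have [g g_hom gE] := proj_lift G_proj p_hom (modhom_comp r_hom f_hom) p_sur.
have [h h_hom hE] := proj_lift P0_proj p_hom (modhom_comp u_hom f_hom) p_sur.
exists ((g \o s) + (h \o v))%VF; first by apply: modhomD; exact: modhom_comp.
by move=> x; rewrite add_lfunE !comp_lfunE linearD /= gE hE !comp_lfunE -linearD -rsuv.
Qed.

(** Projective dimension at most n, one syzygy at a time to allow induction; [projdim_pdim] and
    [pdim_projdim] compare it with whole resolutions, and [pdim_stab] makes the choice of syzygies
    irrelevant. *)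
Fixpoint pdim n X : Prop :=
  if n is m.+1 then exists K P (i : 'Hom(K, P)) (p : 'Hom(P, X)),
    [/\ projective_mod P, ses i p & pdim m K]
  else projective_mod X.

Lemma pdim_stab n C G : stab C G -> pdim n G -> pdim n C.
Proof.
elim: n C G => [|n IHn] C G CG; first exact: stab_proj CG.
case=> K [P [i [p [P_proj Gs K_n]]]].
exists (syzygy C 1), (free_mod R C), (ker_incl (cover C)), (cover C).
have C_free : projective_mod (free_mod R C) by exact: free_mod_projective.
split=> //; first exact: ses_syz.
by apply: IHn K_n; apply: stab_syz CG (ses_syz C) Gs _ _.
Qed.

Lemma pdim_syz n Z K Q (i : 'Hom(K, Q)) (p : 'Hom(Q, Z)) :
  pdim n.+1 Z -> projective_mod Q -> ses i p -> pdim n K.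
Proof.
case=> L [P [j [q [P_proj Zs' L_n]]]] Q_proj Zs.
by apply: pdim_stab L_n; apply: stab_syz (stab_refl Z) Zs Zs' _ _.
Qed.

Fixpoint idim n Y : Prop :=
  if n is m.+1 then exists I Z (j : 'Hom(Y, I)) (q : 'Hom(I, Z)),
    [/\ injective_mod I, ses j q & idim m Z]
  else injective_mod Y.

Lemma inj_extend Y K Q (i : 'Hom(K, Q)) : injective_mod Y -> modhom i ->
  (forall x, i x = 0 -> x = 0) -> extends i Y.
Proof.
move=> Y_inj i_hom /lker_eq0P i_inj f f_hom.
by have [g g_hom <-] := Y_inj _ _ i f i_hom f_hom i_inj; exists g => // x; rewrite comp_lfunE.
Qed.

Lemma ext1_inj Z Y : injective_mod Y -> Ext1_eq0 Z Y.
Proof. by move=> Y_inj K Q i p _ [ih _ iinj _ _ _]; apply: inj_extend. Qed.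

(** This is Ext^(n+1)(X, Y) = 0: each step of the induction trades a syzygy of X for a cosyzygy of
    Y. *)
Lemma ext1_idim n X Y : idim n Y -> Ext1_eq0 (syzygy X n) Y.
Proof.
elim: n Y => [|n IHn] Y; first exact: ext1_inj.
case=> I [Z [j [q [I_inj Ys /IHn Z_n]]]].
apply: ext1_syz (ses_syz (syzygy X n)) Ys _ _ => //; first exact: free_mod_projective.
exact: ext1_inj.
Qed.

Lemma syzygyD X m n : syzygy (syzygy X n) m = syzygy X (m + n).
Proof. by elim: m => //= m ->. Qed.

(* Ext^i(X, Y) = 0 for all i >= 1 *)
Definition Ext_eq0 X Y := forall n, Ext1_eq0 (syzygy X n) Y.

Lemma Ext_idim n X Y : idim n Y -> Ext_eq0 (syzygy X n) Y.
Proof. by move=> Y_n m; rewrite syzygyD addnC -syzygyD; apply: ext1_idim. Qed.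

(** The chosen syzygies of K and of X agree, with a shift by one, only up to stable retracts. Both
    directions are recorded because [stab] is not symmetric by definition. *)
Lemma syzygy_stab X K Q (i : 'Hom(K, Q)) (p : 'Hom(Q, X)) n :
  projective_mod Q -> ses i p ->
  stab (syzygy K n) (syzygy X n.+1) /\ stab (syzygy X n.+1) (syzygy K n).
Proof.
move=> Q_proj Xs; have free M : projective_mod (free_mod R M) by exact: free_mod_projective.
elim: n => [|n [IH1 IH2]].
  by split; [apply: stab_syz (stab_refl X) Xs (ses_syz X) _ _
           | apply: stab_syz (stab_refl X) (ses_syz X) Xs _ _].
by split; [apply: stab_syz IH1 (ses_syz _) (ses_syz _) _ _
         | apply: stab_syz IH2 (ses_syz _) (ses_syz _) _ _].
Qed.

Lemma Ext_syz X Y K Q (i : 'Hom(K, Q)) (p : 'Hom(Q, X)) :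
  projective_mod Q -> ses i p -> Ext_eq0 X Y -> Ext_eq0 K Y.
Proof.
by move=> Q_proj Xs ext n; apply: ext1_stab (syzygy_stab n Q_proj Xs).1 (ext _).
Qed.

Lemma Ext_cosyz X Y K Q (i : 'Hom(K, Q)) (p : 'Hom(Q, X)) :
  projective_mod Q -> ses i p -> Ext1_eq0 X Y -> Ext_eq0 K Y -> Ext_eq0 X Y.
Proof.
move=> Q_proj Xs ext1 ext [|n] //.
exact: ext1_stab (syzygy_stab n Q_proj Xs).2 (ext _).
Qed.

(** In Ext^1(X, Q) -> Ext^1(X, Y) -> Ext^2(X, Y') both ends vanish, the right one by induction
    applied to the syzygy of X. *)
Lemma Ext_pdim n X Y : Ext_eq0 X (regmod R) -> pdim n Y -> Ext1_eq0 X Y.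
Proof.
elim: n X Y => [|n IHn] X Y ext; first exact: ext1_proj (ext 0).
case=> Y' [Q [j [q [Q_proj Ys Y'_n]]]].
have X_free : projective_mod (free_mod R X) by exact: free_mod_projective.
apply: (ext1_of_ses X_free (ses_syz X)) => f f_hom.
have ext' := IHn _ _ (Ext_syz X_free (ses_syz X) ext) Y'_n.
have [g g_hom gE] := ext1_lift ext' Ys f_hom.
have [h h_hom hE] := ext1_proj (ext 0) Q_proj X_free (ses_syz X) g_hom.
exists (q \o h)%VF; first exact: modhom_comp h_hom (ses_p Ys).
by move=> x; rewrite comp_lfunE hE gE.
Qed.

(** For the kernel Y' of a projective presentation Q -> Y, Ext^1(X, Y') = 0, so f lifts to Q. *)
Lemma hom_pdim_factor n X Y (f : 'Hom(X, Y)) :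
    Ext_eq0 X (regmod R) -> pdim n Y -> modhom f ->
  exists P (g : 'Hom(X, P)) (h : 'Hom(P, Y)),
    [/\ projective_mod P, modhom g, modhom h & forall x, h (g x) = f x].
Proof.
case: n => [|n] ext.
  by move=> Y_proj f_hom; exists Y, f, \1%VF; split=> // [|x]; [exact: modhom_id | rewrite id_lfunE].
case=> Y' [Q [j [q [Q_proj Ys Y'_n]]]] f_hom.
have [g g_hom gE] := ext1_lift (Ext_pdim ext Y'_n) Ys f_hom.
by exists Q, g, q; split=> //; exact: ses_p Ys.
Qed.

End Dimension.

(** * Gorenstein projective modules *)

Section GorensteinProjective.
Variables (k : fieldType) (R : falgType k).
Implicit Types C E G I K L M N P Q X Y Z : fdmod R.

(** Kept as data, so that all terms and maps of a complex can be chosen at once by [epsilon];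
    [is_syzygy] is the mere existence of such data. *)
Record proj_ext X Z := ProjExt {
  mid : fdmod R;
  mid_in : 'Hom(X, mid);
  mid_out : 'Hom(mid, Z);
  mid_proj : projective_mod mid;
  mid_ses : ses mid_in mid_out
}.

Definition is_syzygy X Z : Prop := inhabited (proj_ext X Z).

Lemma is_syzygyI X P Z (i : 'Hom(X, P)) (p : 'Hom(P, Z)) :
  projective_mod P -> ses i p -> is_syzygy X Z.
Proof. by move=> P_proj Xs; constructor; exists P i p. Qed.

Definition isom X Y : Prop := exists (s : 'Hom(X, Y)) (r : 'Hom(Y, X)),
  [/\ modhom s, modhom r, cancel s r & cancel r s].

Lemma isom_refl X : isom X X.
Proof. by exists \1%VF, \1%VF; split; try exact: modhom_id; move=> x; rewrite !id_lfunE. Qed.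

Lemma isom_sym X Y : isom X Y -> isom Y X.
Proof. by case=> s [r [s_hom r_hom sK rK]]; exists r, s. Qed.

Lemma isom_stab X Y : isom X Y -> stab X Y.
Proof. by case=> s [r [s_hom r_hom sK _]]; apply: stab_iso sK. Qed.

Lemma is_syzygy_isomL X X' Z : isom X' X -> is_syzygy X Z -> is_syzygy X' Z.
Proof.
case=> s [r [s_hom r_hom sK rK]] [[P i p P_proj Xs]].
exact: is_syzygyI P_proj (ses_isoL s_hom sK rK Xs).
Qed.

Lemma is_syzygy_isomR X Z Z' : isom Z Z' -> is_syzygy X Z -> is_syzygy X Z'.
Proof.
case=> s [r [s_hom r_hom sK rK]] [[P i p P_proj Xs]].
exact: is_syzygyI P_proj (ses_isoR s_hom sK rK Xs).
Qed.

(* The modules Ker (d i) of a totally acyclic complex. *)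
Definition tot_acyclic (K : int -> fdmod R) : Prop :=
  (forall i, is_syzygy (K i) (K (i + 1))) /\ (forall i, Ext1_eq0 (K i) (regmod R)).

Lemma Gproj_tot_acyclic X : Gproj X -> exists2 K, tot_acyclic K & isom X (K 1).
Proof.
case=> P [d [P_proj d_hom d_exact d_ext [j j_hom [j_inj j_img]]]].
pose K i := ker_mod (d_hom i); pose l i : 'Hom(K i, P i) := ker_incl (d i).
have l_hom i : @modhom k R (K i) (P i) (l i) by exact: ker_incl_hom.
have l_inj i x : l i x = 0 -> x = 0.
  by move=> lx0; apply: (@ker_incl_inj _ _ _ _ (d i)); rewrite [LHS]lx0 linear0.
have dl i := (limg_lkerP _ _).1 (ker_incl_img (d i)).
have dd i := (limg_lkerP _ _).1 (d_exact i).
have seq i : exists2 p : 'Hom(P i, K (i + 1)),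
    forall x, l (i + 1) (p x) = d i x & ses (l i) p.
  have [y|p p_hom pE] := factor_inj (l_hom (i + 1)) (d_hom i) (@l_inj _).
    by apply: (dl _).2; apply: (dd i).1.
  exists p => //; split; [exact: l_hom | exact: p_hom | exact: l_inj | | |].
  - by move=> x; apply: l_inj; rewrite pE; apply: (dl i).1.
  - by move=> x px0; apply: (dl i).2; rewrite -pE px0 linear0.
  - move=> z; have [y ly] := (dd i).2 _ ((dl (i + 1)).1 z); exists y.
    by apply/eqP; rewrite -subr_eq0; apply/eqP/l_inj; rewrite linearB /= pE -ly subrr.
exists K; first split=> i.
- by have [p _ pS] := seq i; apply: is_syzygyI pS.
(* Exactness of Hom(P, R) at P (i + 1) is what gives Ext^1(Ker d (i + 3), R) = 0. The index is
   rewritten as a triple successor because the types of the differentials mention i + 1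
   literally. *)
- have -> : i = i - 1 - 1 - 1 + 1 + 1 + 1 by rewrite !subrK.
  move: (i - 1 - 1 - 1) => {}i; have [p pE pS] := seq (i + 1); have [p' p'E p'S] := seq (i + 1 + 1).
  apply: ext1_of_ses p'S _ => // f f_hom.
  have [||g g_hom /lfunP gE] := d_ext i (f \o p)%VF.
  + by apply: modhom_comp f_hom; apply: ses_p pS.
  + apply/lfunP=> x; rewrite !comp_lfunE zero_lfunE.
    suff -> : p (d i x) = 0 by rewrite linear0.
    by apply: l_inj; rewrite pE; apply: (dd i).1.
  exists g => // z; have [y <-] := ses_sur pS z.
  by have := gE y; rewrite !comp_lfunE pE.
have j_inj' := (lker_eq0P j).1 j_inj; have [dj jex] := (limg_lkerP _ _).1 j_img.
have [y|s s_hom sE] := factor_inj (l_hom 1) j_hom (@l_inj _); first exact: (dl 1).2.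
have [y|r r_hom rE] := factor_inj j_hom (l_hom 1) j_inj'.
  by apply: jex; apply: (dl 1).1.
exists s, r; split=> // x; apply/eqP; rewrite -subr_eq0; apply/eqP.
  by apply: j_inj'; rewrite linearB /= rE sE subrr.
by apply: l_inj; rewrite linearB /= sE rE subrr.
Qed.

Lemma tot_acyclic_shift (K : int -> fdmod R) n : tot_acyclic K -> tot_acyclic (fun i => K (i + n)).
Proof. by case=> seq ext; split=> // i; rewrite addrAC. Qed.

Lemma tot_acyclic_Gproj (K : int -> fdmod R) X i : tot_acyclic K -> isom X (K i) -> Gproj X.
Proof.
move=> Kac iso_i; pose K' j := K (j + (i - 1)).
have [seq ext] : tot_acyclic K' by exact: tot_acyclic_shift.
have [s [r [s_hom r_hom sK rK]]] : isom X (K' 1) by rewrite /K' addrC subrK.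
move: {K i Kac iso_i} K' seq ext s r s_hom r_hom sK rK => K seq ext s r s_hom r_hom sK rK.
pose D i : proj_ext (K i) (K (i + 1)) := epsilon (seq i) (fun _ => True).
pose l i := mid_in (D i); pose p i := mid_out (D i).
have S i : ses (l i) (p i) by exact: mid_ses.
have P_proj i : projective_mod (mid (D i)) by exact: mid_proj.
have dE j x : (l (j + 1) \o p j)%VF x = l (j + 1) (p j x) by rewrite comp_lfunE.
exists (fun i => mid (D i)), (fun i => l (i + 1) \o p i)%VF; split=> //.
- by move=> j; apply: modhom_comp; [apply: ses_p (S _) | apply: ses_i (S _)].
- move=> j; apply/limg_lkerP; split=> [x|y]; rewrite dE.
    by rewrite dE (ses_pi (S _)) linear0.
  move/(ses_inj (S _))/(ses_ex (S _))=> [z ->].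
  by have [x <-] := ses_sur (S j) z; exists x; rewrite dE.
- move=> j f f_hom /lfunP fd.
  have [x /(ses_ex (S _))[z ->]|f' f'_hom f'E] :=
      factor_surj (ses_p (S (j + 1))) f_hom (ses_sur (S _)).
    have [x' <-] := ses_sur (S j) z.
    by have := fd x'; rewrite comp_lfunE dE zero_lfunE.
  have [g g_hom gE] := ext _ _ _ _ _ (P_proj (j + 1 + 1)) (S (j + 1 + 1)) f' f'_hom.
  exists g => //; apply/lfunP=> x; rewrite comp_lfunE dE -f'E.
  by rewrite [RHS]gE.
exists (l 1 \o s)%VF; first by apply: modhom_comp s_hom (ses_i (S _)).
split; first by apply/lker_eq0P=> x; rewrite comp_lfunE => /(ses_inj (S _)) sx; rewrite -[x]sK sx linear0.
apply/limg_lkerP; split=> [x|y]; rewrite dE.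
  by rewrite comp_lfunE (ses_pi (S _)) linear0.
move/(ses_inj (S _))/(ses_ex (S _))=> [z ->].
by exists (r z); rewrite comp_lfunE rK.
Qed.

(* Closure of C under one step to the left and one step to the right suffices:
   iterating the two steps builds the total resolution. *)
Lemma Gproj_coind (C : fdmod R -> Prop) :
    (forall X, C X -> [/\ Ext1_eq0 X (regmod R),
       exists2 K, C K & is_syzygy K X & exists2 Y, C Y & is_syzygy X Y]) ->
  forall X, C X -> Gproj X.
Proof.
move=> C_res X CX; pose T := {Y : fdmod R | C Y}.
have ex_prev (Y : T) : exists K : T, is_syzygy (sval K) (sval Y).
  by have [_ [K CK KY] _] := C_res _ (svalP Y); exists (exist _ K CK).
have ex_next (Y : T) : exists Z : T, is_syzygy (sval Y) (sval Z).
  by have [_ _ [Z CZ YZ]] := C_res _ (svalP Y); exists (exist _ Z CZ).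
pose prev (Y : T) := sval (constructive_indefinite_description _ (ex_prev Y)).
pose next (Y : T) := sval (constructive_indefinite_description _ (ex_next Y)).
have prevP (Y : T) : is_syzygy (sval (prev Y)) (sval Y) by rewrite /prev; case: constructive_indefinite_description.
have nextP (Y : T) : is_syzygy (sval Y) (sval (next Y)) by rewrite /next; case: constructive_indefinite_description.
pose X0 : T := exist _ X CX.
(* [Negz n] is -(n + 1), hence n + 1 steps to the left. *)
pose F (i : int) : T := match i with Posz n => iter n next X0 | Negz n => iter n.+1 prev X0 end.
apply: (@tot_acyclic_Gproj (fun i => sval (F i)) X 0); last exact: isom_refl.
split=> i; last by have [] := C_res _ (svalP (F i)).
case: i => n; first by rewrite -PoszD addn1; apply: nextP.
have -> : Negz n + 1 = - n%:Z by rewrite NegzE -addn1 PoszD opprD addrNK.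
case: n => [|n]; first by rewrite oppr0; apply: prevP.
by rewrite -NegzE; apply: prevP.
Qed.

Lemma Gproj_unfold X : Gproj X ->
  [/\ Ext1_eq0 X (regmod R),
      exists2 K, Gproj K & is_syzygy K X & exists2 Y, Gproj Y & is_syzygy X Y].
Proof.
case/Gproj_tot_acyclic=> K Kac iso1; have [seq ext] := Kac.
split; first exact: ext1_stab (isom_stab iso1) (ext 1).
  exists (K 0); first exact: tot_acyclic_Gproj (isom_refl _).
  by apply: is_syzygy_isomR (isom_sym iso1) _; have := seq 0; rewrite add0r.
exists (K (1 + 1)); first exact: tot_acyclic_Gproj (isom_refl _).
exact: is_syzygy_isomL iso1 (seq 1).
Qed.

(** Schanuel's lemma turned around: maps to projectives extend along i and j instead of lifting
    through p and q. The endomorphism h kills i(C), so it factors through p, and Q becomes the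
    projective summand. *)
Lemma stab_cosyz C G C1 Q G1 P (i : 'Hom(C, Q)) (p : 'Hom(Q, C1))
    (j : 'Hom(G, P)) (q : 'Hom(P, G1)) :
    stab C G -> ses i p -> ses j q -> projective_mod Q -> projective_mod P ->
    extends i (regmod R) -> extends j (regmod R) ->
  stab C1 G1.
Proof.
case=> P0 [s [r [v [u [P0_proj [s_hom r_hom v_hom u_hom] rsuv]]]]].
case=> ih ph iinj pi iex psur [jh qh jinj qj jex qsur] Q_proj P_proj i_ext j_ext.
have [S S_hom SE] := extends_proj i_ext P_proj (modhom_comp s_hom jh).
have [T T_hom TE] := extends_proj j_ext Q_proj (modhom_comp r_hom ih).
have [v' v'_hom v'E] := extends_proj i_ext P0_proj v_hom.
pose h : 'Hom(Q, Q) := (\1 - (T \o S) - (i \o (u \o v')))%VF.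
have hE x : h x = x - T (S x) - i (u (v' x)).
  by rewrite !(add_lfunE, opp_lfunE, comp_lfunE, id_lfunE).
have h_hom : modhom h.
  apply: modhomB; first by apply: modhomB; [exact: modhom_id | exact: modhom_comp].
  exact/modhom_comp/ih/modhom_comp.
have [x /iex[c ->]|s1 s1_hom s1E] := factor_surj ph (modhom_comp S_hom qh) psur.
  by rewrite comp_lfunE SE comp_lfunE qj.
have [x /jex[c ->]|r1 r1_hom r1E] := factor_surj qh (modhom_comp T_hom ph) qsur.
  by rewrite comp_lfunE TE comp_lfunE pi.
have [x /iex[c ->]|w w_hom wE] := factor_surj ph h_hom psur.
  rewrite hE SE comp_lfunE TE comp_lfunE v'E.
  by rewrite -addrA -opprD -linearD -rsuv subrr.
exists Q, s1, r1, w, p; split=> // y; have [x <-] := psur y.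
rewrite s1E comp_lfunE r1E comp_lfunE wE hE !linearB /= pi subr0.
by rewrite addrC subrK.
Qed.

(** Every map from K to a projective factors through i, so Ker i lies in the kernel of each of
    them. *)
Lemma extends_mono K Q (i : 'Hom(K, Q)) X P (j : 'Hom(K, P)) :
    extends i (regmod R) -> projective_mod P -> modhom j ->
  forall x, i x = 0 -> j x = 0.
Proof.
move=> i_ext P_proj j_hom x ix0.
by have [g _ gE] := extends_proj i_ext P_proj j_hom; rewrite -gE ix0 linear0.
Qed.

(* Stable retracts rather than direct summands: Schanuel's lemma then gives the
   independence of Gproj from the chosen syzygies and cosyzygies. *)
Lemma Gproj_stab C G : stab C G -> Gproj G -> Gproj C.
Proof.
move=> CG G_Gproj; apply: (@Gproj_coind (fun C => exists2 G, Gproj G & stab C G)); last by exists G.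
move=> {C G CG G_Gproj} C [G G_Gproj CG].
have [ext [L L_Gproj [[P j q P_proj Ls]]] [Y Y_Gproj [[P' j' q' P'_proj Gs]]]] :=
  Gproj_unfold G_Gproj.
have C_free : projective_mod (free_mod R C) by exact: free_mod_projective.
split; first exact: ext1_stab ext.
  exists (syzygy C 1); last exact: is_syzygyI (ses_syz C).
  by exists L => //; apply: stab_syz CG (ses_syz C) Ls _ _.
have [Q [i [Q_proj i_hom i_ext]]] := free_approx C.
(* An element x of Ker i is killed by v and by j' s, both maps to projectives. As j' is injective, s
   x = 0, and x = r (s x) + u (v x) vanishes. *)
have [x|C1 [p Cs]] := ses_coker i_hom.
  have [P0 [s [r [v [u [P0_proj [s_hom r_hom v_hom u_hom] rsuv]]]]]] := CG.
  move=> ix0; rewrite [x]rsuv (extends_mono C i_ext P0_proj v_hom ix0).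
  suff -> : s x = 0 by rewrite !linear0 addr0.
  apply: (ses_inj Gs); rewrite -[j' _]comp_lfunE.
  apply: (extends_mono C i_ext P'_proj (modhom_comp s_hom (ses_i Gs)) ix0).
exists C1; last exact: is_syzygyI Cs.
exists Y => //; apply: (stab_cosyz CG Cs Gs) => //.
by have [Y_ext _ _] := Gproj_unfold Y_Gproj; exact: Y_ext P'_proj Gs.
Qed.

Lemma Gproj_syz G K : Gproj G -> is_syzygy K G -> Gproj K.
Proof.
move=> G_Gproj [[Q i p Q_proj Ks]].
have [_ [L L_Gproj [[P j q P_proj Ls]]] _] := Gproj_unfold G_Gproj.
by apply: Gproj_stab L_Gproj; apply: stab_syz (stab_refl G) Ks Ls _ _.
Qed.

Lemma Gproj_cosyz G C Q (i : 'Hom(G, Q)) (p : 'Hom(Q, C)) :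
    Gproj G -> projective_mod Q -> ses i p -> extends i (regmod R) ->
  Gproj C.
Proof.
move=> G_Gproj Q_proj Gs i_ext.
have [_ _ [Y Y_Gproj [[P j q P_proj Ys]]]] := Gproj_unfold G_Gproj.
have [Y_ext _ _] := Gproj_unfold Y_Gproj.
apply: Gproj_stab Y_Gproj; apply: (stab_cosyz (stab_refl G) Gs Ys) => //.
exact: Y_ext P_proj Ys.
Qed.

Lemma Gproj_Ext G : Gproj G -> Ext_eq0 G (regmod R).
Proof.
move=> G_Gproj n; suff /Gproj_unfold[] : Gproj (syzygy G n) by [].
elim: n => //= n IHn; apply: Gproj_syz IHn _; apply: is_syzygyI (ses_syz _).
exact: free_mod_projective.
Qed.

End GorensteinProjective.

(** * Gorenstein algebras *)

Section Resolutions.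
Variables (k : fieldType) (R : falgType k).
Implicit Types C E G I K L M N P Q X Y Z : fdmod R.

Lemma zero_modP M : zero_mod M <-> forall x : M, x = 0.
Proof.
split=> [M0 x | M0]; first by apply/eqP; rewrite -memv0 -[0%VS]M0 memvf.
by apply/vspaceP=> x; rewrite memvf memv0 (M0 x) eqxx.
Qed.

Lemma zero_mod_exists : exists M, zero_mod M.
Proof.
exists (ker_mod (@modhom_id k R (regmod R))); apply/zero_modP=> x.
apply: (@ker_incl_inj _ _ (regmod R) (regmod R) \1%VF); rewrite [RHS]linear0.
have [i0 _] := (limg_lkerP _ _).1 (@ker_incl_img k R (regmod R) (regmod R) \1%VF).
by have := i0 x; rewrite id_lfunE.
Qed.

Lemma inj_retract I X (s : 'Hom(X, I)) (r : 'Hom(I, X)) :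
    injective_mod I -> modhom s -> modhom r -> (forall x, r (s x) = x) ->
  injective_mod X.
Proof.
move=> I_inj s_hom r_hom rs M N i f i_hom f_hom i_inj.
have [g g_hom gE] := inj_extend I_inj i_hom ((lker_eq0P i).1 i_inj) (modhom_comp f_hom s_hom).
exists (r \o g)%VF; first exact: modhom_comp.
by apply/lfunP=> x; rewrite !comp_lfunE gE comp_lfunE rs.
Qed.

Lemma injdim_idim n X : injdim_le X n -> idim n X.
Proof.
case=> I [d [e [res I0]]]; elim: n X I d e res I0 => [|n IHn] X I d e res I0.
  have [I_inj d_hom e_hom /lker_eq0P e_inj /limg_lkerP[de ex] _] := res.
  have [x|r r_hom rE] := factor_inj e_hom (@modhom_id _ _ (I 0)) e_inj.
    by rewrite id_lfunE; apply: ex; apply: (zero_modP _).1 _ (d 0 x); apply: I0.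
  apply: (inj_retract (I_inj 0) e_hom r_hom) => x.
  by apply/eqP; rewrite -subr_eq0; apply/eqP/e_inj; rewrite linearB /= rE id_lfunE subrr.
have [I_inj d_hom e_hom /lker_eq0P e_inj /limg_lkerP[de ex] d_ex] := res.
have [Z [p Xs]] := ses_coker e_hom e_inj.
exists (I 0), Z, e, p; split=> //.
have [ih ph iinj pi iex psur] := Xs.
have [x /iex[z ->]|e' e'_hom e'E] := factor_surj ph (d_hom 0) psur; first exact: de.
apply: (IHn Z (fun m => I m.+1) (fun m => d m.+1) e'); last by move=> m nm; apply: I0.
have /limg_lkerP[dd dex] := d_ex 0.
split=> //.
- apply/lker_eq0P=> z; have [x <-] := psur z.
  by rewrite e'E => /ex[y ->].
- apply/limg_lkerP; split=> [z|y /dex[x ->]].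
    by have [x <-] := psur z; rewrite e'E; apply: dd.
  by exists (p x); rewrite e'E.
Qed.

(** Cuts off the short exact sequence at P 0; repeated use splits a resolution into short exact
    sequences. *)
Lemma proj_resolution_shift X (P : nat -> fdmod R) (d : forall n, 'Hom(P n.+1, P n))
    (e : 'Hom(P 0, X)) : proj_resolution d e ->
  exists K (i : 'Hom(K, P 0)) (e' : 'Hom(P 1, K)),
    [/\ ses i e, forall y, i (e' y) = d 0 y
      & @proj_resolution k R K (fun m => P m.+1) (fun m => d m.+1) e'].
Proof.
case=> P_proj d_hom e_hom /limg_fullP e_sur /limg_lkerP[ed ex] d_ex.
have Xs := ses_ker e_hom e_sur; have [ih ph iinj pi iex psur] := Xs.
have [y|e' e'_hom e'E] := factor_inj ih (d_hom 0) iinj; first exact/iex/ed.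
exists (ker_mod e_hom), (ker_incl e), e'; split=> //.
have /limg_lkerP[dd dex] := d_ex 0.
split=> //.
- apply/limg_fullP=> z; have [y yE] := ex _ (pi z); exists y.
  apply/eqP; rewrite -subr_eq0; apply/eqP/iinj.
  by rewrite linearB /= e'E -yE subrr.
- apply/limg_lkerP; split=> [x|y e'y0].
    by apply: iinj; rewrite e'E; apply: dd.
  by apply: dex; rewrite -e'E e'y0 linear0.
Qed.

Lemma projdim_pdim n X : projdim_le X n -> pdim n X.
Proof.
case=> P [d [e [res P0]]]; elim: n X P d e res P0 => [|n IHn] X P d e res P0.
  have [P_proj d_hom e_hom /limg_fullP e_sur /limg_lkerP[ed ex] _] := res.
  have [x /ex[y ->]|s s_hom sE] := factor_surj e_hom (@modhom_id _ _ (P 0)) e_sur.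
    by rewrite ((zero_modP (P 1)).1 (P0 1 isT) y) linear0 id_lfunE.
  apply: (proj_retract (P_proj 0) s_hom e_hom) => x.
  by have [y <-] := e_sur x; rewrite sE id_lfunE.
have [K [i [e' [Xs _ resK]]]] := proj_resolution_shift res.
exists K, (P 0), i, e; split=> //; first by case: res.
by apply: (IHn _ _ _ _ resK) => m nm; apply: P0.
Qed.

Lemma pdim_projdim n X : pdim n X -> projdim_le X n.
Proof.
have [Z0 Z0P] := zero_mod_exists; have {}Z0P := (zero_modP _).1 Z0P.
elim: n X => [|n IHn] X.
  move=> X_proj; pose P n := if n is 0 then X else Z0.
  exists P, (fun _ => 0), \1%VF; split=> [|[|m] // _]; last exact/zero_modP.
  split=> [[|m] //|m r x||||m].
  - by move=> M N p f _ _ _; exists 0 => [r x|]; [rewrite !zero_lfunE linear0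
      | apply/lfunP=> x; rewrite (Z0P x) !linear0].
  - by rewrite !zero_lfunE linear0.
  - exact: modhom_id.
  - by apply/limg_fullP=> y; exists y; rewrite id_lfunE.
  - apply/limg_lkerP; split=> [x|y]; first by rewrite !zero_lfunE linear0.
    by rewrite id_lfunE => ->; exists 0; rewrite linear0.
  - apply/limg_lkerP; split=> [x|y _]; first by rewrite !zero_lfunE.
    by exists 0; rewrite (Z0P y) linear0.
case=> K [Q [i [p [Q_proj [ih ph iinj pi iex psur] /IHn[P [d [e [res P0]]]]]]]].
pose P' m := if m is m'.+1 then P m' else Q.
pose d' m : 'Hom(P' m.+1, P' m) :=
  match m return 'Hom(P' m.+1, P' m) with 0 => (i \o e)%VF | m'.+1 => d m' end.
exists P', d', p; split=> [|[|m] // nm]; last exact: P0.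
have [P_proj d_hom e_hom /limg_fullP e_sur /limg_lkerP[ed ex] d_ex] := res.
split=> // [[|m]|[|m]|||[|m]].
- exact: Q_proj.
- exact: P_proj.
- exact: modhom_comp.
- exact: d_hom.
- exact/limg_fullP.
- apply/limg_lkerP; split=> [x|y /iex[z ->]]; first by rewrite comp_lfunE pi.
  by have [x <-] := e_sur z; exists x; rewrite comp_lfunE.
- apply/limg_lkerP; split=> [x|y]; rewrite comp_lfunE; first by rewrite ed linear0.
  by move/iinj/ex.
- exact: d_ex.
Qed.

Lemma pdim_syzygy n X : projective_mod (syzygy X n) -> pdim n X.
Proof.
elim: n X => [|n IHn] X // X_n.
exists (syzygy X 1), (free_mod R X), (ker_incl (cover X)), (cover X); split.
- exact: free_mod_projective.
- exact: ses_syz.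
- by apply: IHn; rewrite syzygyD addn1.
Qed.

End Resolutions.

(** * Duality over k, from injective right modules to projective left modules *)

Section LinearDuality.
Variables (k : fieldType) (V W : vectType k).

Definition vcoord (i : 'I_(dim V)) : 'Hom(V, k^o) :=
  linfun (fun v : V => v2r v 0 i : k^o).

Lemma vcoordE i v : vcoord i v = v2r v 0 i.
Proof. by apply: linfun_linE => c x y; rewrite linearP !mxE. Qed.

Lemma functional_expand (h : 'Hom(V, k^o)) : h = \sum_i h (tbase i) *: vcoord i.
Proof.
apply/lfunP=> v; rewrite {1}[v]tbase_expand linear_sum sum_lfunE.
by apply: eq_bigr => i _; rewrite linearZ scale_lfunE /= vcoordE; apply: mulrC.
Qed.

Lemma functional_sep (v : V) : (forall h : 'Hom(V, k^o), h v = 0) -> v = 0.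
Proof.
move=> v0; rewrite [v]tbase_expand big1 // => i _.
by rewrite -vcoordE v0 scale0r.
Qed.

Lemma functional_inj (v w : V) : (forall h : 'Hom(V, k^o), h v = h w) -> v = w.
Proof.
move=> vw; apply/eqP; rewrite -subr_eq0; apply/eqP/functional_sep => h.
by rewrite linearB /= vw subrr.
Qed.

(** Finite dimensional spaces are reflexive. This is used to define a map by prescribing its values
    under all functionals. *)
Lemma undual (F : 'Hom(W, 'Hom('Hom(V, k^o), k^o))) :
  exists g : 'Hom(W, V), forall w (h : 'Hom(V, k^o)), h (g w) = F w h.
Proof.
pose g w := \sum_i (F w (vcoord i) : k) *: tbase i.
have g_lin : linear g.
  move=> c x y; rewrite /g scaler_sumr -big_split; apply: eq_bigr => i _ /=.
  by rewrite linearP add_lfunE scale_lfunE scalerDl scalerA.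
exists (linfun g) => w h; rewrite linfun_linE // linear_sum.
rewrite [in RHS](functional_expand h) linear_sum; apply: eq_bigr => i _.
by rewrite !linearZ; apply: mulrC.
Qed.

End LinearDuality.

Section HomMod.
Variables (k : fieldType) (R : falgType k) (V : rmod R) (U : vectType k).

Definition hom_act (r : R) : 'End('Hom(V, U)) :=
  linfun (fun f : 'Hom(V, U) => (f \o act V r)%VF).

Lemma hom_actE (r : R) (f : 'Hom(V, U)) : hom_act r f = (f \o act V r)%VF.
Proof. by apply: linfun_linE => c g h; rewrite comp_lfunDl comp_lfunZl. Qed.

Fact hom_act_linear : linear hom_act.
Proof.
move=> c r s; apply/lfunP=> f; rewrite add_lfunE scale_lfunE !hom_actE.
by rewrite (@act_linear _ _ V) comp_lfunDr comp_lfunZr.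
Qed.

Fact hom_act1 : hom_act 1 = \1%VF.
Proof. by apply/lfunP=> f; rewrite hom_actE id_lfunE (@act1 _ _ V) comp_lfun1r. Qed.

Fact hom_actM (r s : R) : hom_act (r * s) = (hom_act r \o hom_act s)%VF.
Proof.
apply/lfunP=> f; rewrite comp_lfunE !hom_actE -comp_lfunA.
by rewrite -(@actM _ _ V).
Qed.

(* Hom_k(V, U), with (r f)(v) = f (v r). *)
Definition hom_mod : fdmod R := FdMod hom_act_linear hom_act1 hom_actM.

Lemma hom_modE r (f : 'Hom(V, U)) v : act hom_mod r f v = f (act V r v).
Proof. by rewrite [act _ _ _]hom_actE comp_lfunE. Qed.

End HomMod.

Section ModuleDuality.
Variables (k : fieldType) (R : falgType k).

(** The duality from right to left modules: [dual] applied to a right module would give a module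
    over the double opposite of R. *)
Definition codual (V : rmod R) : fdmod R := hom_mod V k^o.

Lemma codual_modE (V : rmod R) r (f : 'Hom(V, k^o)) v : act (codual V) r f v = f (act V r v).
Proof. exact: hom_modE. Qed.

Lemma dual_modE (M : fdmod R) (r : R^c) (f : 'Hom(M, k^o)) x :
  act (dual M) r f x = f (act M r x).
Proof. by rewrite [act _ _ _]dual_actE comp_lfunE. Qed.

Definition precomp (U V W : vectType k) (f : 'Hom(U, V)) : 'Hom('Hom(V, W), 'Hom(U, W)) :=
  linfun (fun h : 'Hom(V, W) => (h \o f)%VF).

Lemma precompE (U V W : vectType k) (f : 'Hom(U, V)) (h : 'Hom(V, W)) :
  precomp W f h = (h \o f)%VF.
Proof. by apply: linfun_linE => c g g'; rewrite comp_lfunDl comp_lfunZl. Qed.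

Lemma precomp_hom (V V' : rmod R) (f : 'Hom(V, V')) :
  modhom f -> @modhom k R (codual V') (codual V) (precomp k^o f).
Proof.
move=> f_hom r h; apply/lfunP=> v.
rewrite precompE comp_lfunE; apply: etrans (codual_modE _ _ _) _; apply/esym.
by apply: etrans (codual_modE _ _ _) _; rewrite precompE comp_lfunE f_hom.
Qed.

Lemma codual_ses (X Y Z : rmod R) (i : 'Hom(X, Y)) (p : 'Hom(Y, Z)) :
  ses i p -> @ses k R (codual Z) (codual Y) (codual X) (precomp k^o p) (precomp k^o i).
Proof.
case=> ih ph iinj pi iex psur; split.
- exact: precomp_hom.
- exact: precomp_hom.
- move=> h; rewrite precompE => /lfunP hp; apply/lfunP=> z.
  by have [y <-] := psur z; have := hp y; rewrite comp_lfunE !zero_lfunE.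
- by move=> h; apply/lfunP=> x; rewrite !precompE !comp_lfunE pi zero_lfunE linear0.
- move=> h; rewrite precompE => /lfunP hi; exists (h \o p^-1)%VF; apply/lfunP=> y.
  rewrite precompE !comp_lfunE; apply/eqP; rewrite -subr_eq0 -linearB.
  have [|x ->] := iex (y - p^-1%VF (p y)).
    by rewrite linearB /= limg_lfunV ?subrr //; exists y.
  by have := hi x; rewrite comp_lfunE zero_lfunE => /eqP.
- move=> h; exists (h \o i^-1)%VF; apply/lfunP=> x.
  by rewrite precompE !comp_lfunE lfunV_inj.
Qed.

(** Lifting f : DI -> N through p : M -> N is, after dualising, extending f' : DN -> I along the
    injection Dp : DN -> DM. *)
Lemma codual_proj (I : rmod R) : injective_mod I -> projective_mod (codual I).
Proof.
move=> I_inj; apply: projI => M N p f p_hom f_hom psur.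
pose DM : rmod R := dual M; pose DN : rmod R := dual N.
have p_dual : @modhom k R^c DN DM (precomp k^o p).
  move=> r h; apply/lfunP=> x; rewrite precompE comp_lfunE.
  apply: etrans (dual_modE _ _ _) _; apply/esym; apply: etrans (dual_modE _ _ _) _.
  by rewrite precompE comp_lfunE p_hom.
have [f' f'E] := undual (precomp k^o f : 'Hom(DN, 'Hom('Hom(I, k^o), k^o))).
have f'_hom : @modhom k R^c DN I f'.
  move=> r h; apply: functional_inj => u; rewrite f'E precompE comp_lfunE.
  apply: etrans (dual_modE _ _ _) _; rewrite -f_hom; apply/esym.
  by apply: etrans (esym (codual_modE r u _)) _; rewrite f'E precompE comp_lfunE.
have [h|g' g'_hom g'E] := inj_extend I_inj p_dual _ f'_hom.
  rewrite precompE => /lfunP hp; apply/lfunP=> z.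
  by have [y <-] := psur z; have := hp y; rewrite comp_lfunE !zero_lfunE.
have [g gE] : exists g : 'Hom(codual I, M), forall u (h : 'Hom(M, k^o)),
    h (g u) = (u : 'Hom(I, k^o)) (g' h).
  have [g gE] := undual (linfun (fun u : 'Hom(I, k^o) => (u \o g')%VF)).
  exists g => u h; rewrite gE linfun_linE ?comp_lfunE // => c a b.
  by rewrite comp_lfunDl comp_lfunZl.
exists g => [r u|u]; apply: functional_inj => h.
  rewrite gE; apply: etrans (codual_modE _ _ _) _; rewrite -g'_hom -gE.
  exact: dual_modE.
rewrite -[LHS]comp_lfunE -precompE gE g'E f'E precompE comp_lfunE.
by [].
Qed.

Lemma codual_pdim n (V : rmod R) : idim n V -> pdim n (codual V).
Proof.
elim: n V => [|n IHn] V; first exact: codual_proj.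
case=> I [Z [j [q [I_inj Vs /IHn Z_n]]]].
exists (codual Z), (codual I), (precomp k^o q), (precomp k^o j); split=> //.
  exact: codual_proj.
exact: codual_ses.
Qed.

End ModuleDuality.

(** * Gorenstein projective modules over Gorenstein algebras *)

Section Gorenstein.
Variables (k : fieldType) (R : falgType k).
Implicit Types C E G I K L M N P Q X Y Z : fdmod R.

(* X embeds in a projective module because each functional on X is the value at 1
   of a map from X to D(R), which factors through a projective module since D(R)
   has finite projective dimension. *)
Lemma Gorenstein_Gproj n X :
  idim n (regmod R^c) -> Ext_eq0 X (regmod R) -> Gproj X.
Proof.
move=> /codual_pdim J_n; set J := codual _ in J_n.
apply: (@Gproj_coind _ _ (fun X => Ext_eq0 X (regmod R))) => {}X ext.
have X_free : projective_mod (free_mod R X) by exact: free_mod_projective.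
split; first exact: ext 0.
  exists (syzygy X 1); last exact: is_syzygyI (ses_syz X).
  exact: Ext_syz X_free (ses_syz X) ext.
have [P [i [P_proj i_hom i_ext]]] := free_approx X.
have i_inj x : i x = 0 -> x = 0.
  move=> ix0; apply: functional_sep => h.
  pose u (y : X) : 'Hom(regmod R^c, k^o) := linfun (fun b : R => h (act X b y)).
  have uE y b : u y b = h (act X b y).
    by apply: linfun_linE => c b1 b2; rewrite act_linear add_lfunE scale_lfunE linearP.
  have u_lin : linear u.
    by move=> c y z; apply/lfunP=> b; rewrite add_lfunE scale_lfunE !uE !linearP.
  have u_hom : @modhom k R X J (linfun u).
    move=> r y; apply/lfunP=> b; rewrite linfun_linE // uE; apply/esym.
    apply: etrans (@codual_modE _ R (regmod R^c) r (linfun u y) b) _.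
    by rewrite linfun_linE // uE -actME; congr (h (act X _ y)); rewrite lfunE.
  have [Q [a [b [Q_proj a_hom b_hom baE]]]] := hom_pdim_factor ext J_n u_hom.
  have := baE x; rewrite (extends_mono X i_ext Q_proj a_hom ix0) linear0 linfun_linE //.
  by move=> /(congr1 (fun f : 'Hom(regmod R^c, k^o) => f (1 : R))); rewrite uE act1E zero_lfunE.
have [C [p Xs]] := ses_coker i_hom i_inj.
exists C; last exact: is_syzygyI Xs.
apply: (Ext_cosyz P_proj Xs) => //.
exact: ext1_of_ses P_proj Xs i_ext.
Qed.

(** The bound is the left injective dimension n of R, since Ext^i(Omega^n X, R) = 0 for all i >= 1.
    The right injective dimension enters through [Gorenstein_Gproj], which makes Omega^n X
    Gorenstein projective. *)
Lemma gldim_of_Gproj_proj :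
  Gorenstein R -> (forall X, Gproj X -> projective_mod X) -> gldim_finite R.
Proof.
case=> [[n /injdim_idim R_n] [m /injdim_idim Rc_m]] GP; exists n => X.
apply/pdim_projdim/pdim_syzygy/GP/(Gorenstein_Gproj Rc_m).
exact: Ext_idim.
Qed.

End Gorenstein.

(** * The functors (A (x) V) (x)_L - *)

Section LinearTools.
Variables (k : fieldType).

Lemma linear_factor (V W U : vectType k) (p : 'Hom(V, W)) (f : 'Hom(V, U)) :
    (forall x, p x = 0 -> f x = 0) -> exists g : 'Hom(W, U), forall x, g (p x) = f x.
Proof.
move=> pf; exists (f \o p^-1)%VF => x; rewrite comp_lfunE.
apply/eqP; rewrite -subr_eq0 -linearB; apply/eqP/pf.
by rewrite linearB /= limg_lfunV ?subrr //; exists x.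
Qed.

Lemma btens_lift (R : falgType k) (M : rmod R) (N : fdmod R) (U : vectType k)
    (f : M -> N -> U) :
    bilinear_map f -> (forall (r : R) m n, f (act M r m) n = f m (act N r n)) ->
  exists g : 'Hom(btens M N, U), forall m n, g (bpure m n) = f m n.
Proof.
move=> f_bil f_bal; pose F := tlift f.
have [|g gE] := @linear_factor _ _ _ (qproj (brel M N)) F.
  move=> t /eqP; rewrite -memv_ker qproj_ker => /memv_imgP[x _ ->].
  elim/tens_ind: x => [r y|c x y IHx IHy]; last by rewrite !linearP /= IHx IHy scaler0 addr0.
  elim/tens_ind: y => [m n|c x y IHx IHy].
    by rewrite bdiff_pure linearB /= !tmap_pure !id_lfunE !tlift_pure // f_bal subrr.
  have [pr _] := tpure_bilinear R (tens M N).
  by rewrite pr !linearP /= IHx IHy scaler0 addr0.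
by exists g => m n; rewrite gE /F tlift_pure.
Qed.

Definition postcomp (U V W : vectType k) (f : 'Hom(V, W)) : 'Hom('Hom(U, V), 'Hom(U, W)) :=
  linfun (fun h : 'Hom(U, V) => (f \o h)%VF).

Lemma postcompE (U V W : vectType k) (f : 'Hom(V, W)) (h : 'Hom(U, V)) :
  postcomp U f h = (f \o h)%VF.
Proof. by apply: linfun_linE => c g g'; rewrite comp_lfunDr comp_lfunZr. Qed.

End LinearTools.

Section OuterProduct.
Variables (k : fieldType) (A B : falgType k).
Local Notation L := (talg A B).
Implicit Types (X Z : fdmod L) (V : rmod B) (Y : fdmod A).

Lemma talg_pureM (a a' : A) (b b' : B) :
  (tpure a b : L) * (tpure a' b' : L) = tpure (a * a') (b * b').
Proof. exact: tmull_pure. Qed.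

Lemma modhom_pure X Z (f : 'Hom(X, Z)) :
    (forall a b x, f (act X (tpure a b : L) x) = act Z (tpure a b : L) (f x)) ->
  modhom f.
Proof.
move=> f_pure r x; elim/tens_ind: r => [a b|c r s IHr IHs]; first exact: f_pure.
by rewrite !act_linear !add_lfunE !scale_lfunE linearP /= IHr IHs.
Qed.

Section Restriction.
Variable X : fdmod L.

Definition res_act (b : B) : 'End(X) := act X (tpure 1 b : L).

Fact res_act_linear : linear res_act.
Proof.
by move=> c b b'; rewrite /res_act -act_linear; have [pr _] := tpure_bilinear A B; rewrite pr.
Qed.

Fact res_act1 : res_act 1 = \1%VF.
Proof. exact: act1. Qed.

Fact res_actM (b b' : B) : res_act (b * b') = (res_act b \o res_act b')%VF.
Proof. by rewrite /res_act -actM talg_pureM mulr1. Qed.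

Definition res : fdmod B := FdMod res_act_linear res_act1 res_actM.

Lemma resE b x : act res b x = act X (tpure 1 b : L) x.
Proof. by []. Qed.

End Restriction.

Lemma res_hom X Z (f : 'Hom(X, Z)) : modhom f -> @modhom k B (res X) (res Z) f.
Proof. by move=> f_hom b x; rewrite !resE f_hom. Qed.

Lemma res_ses X (Y0 : fdmod L) Z (i : 'Hom(X, Y0)) (p : 'Hom(Y0, Z)) :
  @ses k L X Y0 Z i p -> @ses k B (res X) (res Y0) (res Z) i p.
Proof. by case=> ih ph *; split=> //; exact: res_hom. Qed.

(** Over B, the module L (x) W is free on A (x) W: the lift is prescribed on the elements (a (x) 1)
    (x) w through the linear pseudo-inverse of p. *)
Lemma res_free_proj (W : vectType k) : projective_mod (res (free_mod L W)).
Proof.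
apply: projI => M N p f p_hom f_hom p_sur.
pose f0 w a b : M := act M b (p^-1%VF (f (tpure (tpure a 1 : L) w))).
have f0_bil w : bilinear_map (f0 w).
  have [_ pl1] := tpure_bilinear A B; have [_ pl2] := tpure_bilinear L W.
  by split=> [a|b] c x y; rewrite /f0 ?act_linear ?add_lfunE ?scale_lfunE // pl1 pl2 !linearP.
pose g0 (l : L) w := tlift (f0 w) l.
have g0_bil : bilinear_map g0.
  split=> [l|w] c x y; rewrite /g0; last by rewrite linearP.
  elim/tens_ind: l => [a b|c' l l' IHl IHl'].
    have [pr2 _] := tpure_bilinear L W.
    by rewrite !tlift_pure // /f0 pr2 !linearP.
  by rewrite !linearP /= IHl IHl' !scalerDr !scalerA addrACA mulrC -scalerA.
have gE a b w : tlift g0 (tpure (tpure a b : L) w) = f0 w a b.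
  by rewrite tlift_pure // /g0 tlift_pure.
exists (tlift g0) => [b' x|x]; elim/tens_ind: x => [l w|c x y IHx IHy].
- elim/tens_ind: l => [a b|c x y IHx IHy].
    rewrite resE [act _ _ _]free_act_pure talg_pureM mul1r !gE /f0.
    by rewrite actME.
  have [_ pl2] := tpure_bilinear L W.
  by rewrite pl2 !linearP /= IHx IHy.
- by rewrite !linearP /= IHx IHy.
- elim/tens_ind: l => [a b|c x y IHx IHy].
    rewrite gE /f0 p_hom limg_lfunV; last by [].
    by rewrite -f_hom resE [act _ _ _]free_act_pure talg_pureM mul1r mulr1.
  have [_ pl2] := tpure_bilinear L W.
  by rewrite pl2 !linearP /= IHx IHy.
- by rewrite !linearP /= IHx IHy.
Qed.

Lemma res_proj X : projective_mod X -> projective_mod (res X).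
Proof.
move=> /proj_cover_retract[s s_hom sK].
exact: (@proj_retract _ _ _ (res X) _ _ (@res_free_proj X) (res_hom s_hom) (res_hom (@cover_hom _ _ X)) sK).
Qed.

Section HomBimodule.
Variables (V : rmod B) (Y : fdmod A).

Definition hom2_act (x : L) : 'End('Hom(V, Y)) :=
  tlift (fun (a : A) (b : B) => (postcomp V (act Y a) \o precomp Y (act V b))%VF) x.

Lemma hom2_act_pure a b h v : hom2_act (tpure a b) h v = act Y a (h (act V b v)).
Proof.
rewrite /hom2_act tlift_pure; first by rewrite comp_lfunE precompE postcompE !comp_lfunE.
split=> [u|u] c x y; apply/lfunP=> f; apply/lfunP=> w;
  rewrite !(add_lfunE, scale_lfunE, comp_lfunE, precompE, postcompE) ?act_linear.
  by rewrite add_lfunE scale_lfunE !linearP.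
by rewrite add_lfunE scale_lfunE.
Qed.

Fact hom2_act_linear : linear hom2_act.
Proof. by move=> c x y; rewrite /hom2_act linearP. Qed.

Fact hom2_act1 : hom2_act 1 = \1%VF.
Proof.
apply/lfunP=> h; apply/lfunP=> v.
by rewrite hom2_act_pure act1E (@act1E _ _ V) id_lfunE.
Qed.

Fact hom2_actM (x y : L) : hom2_act (x * y) = (hom2_act x \o hom2_act y)%VF.
Proof.
elim/tens_ind: x => [a b|c x x' IHx IHx']; last first.
  by rewrite mulrDl -scalerAl !hom2_act_linear comp_lfunDl -comp_lfunZl IHx IHx'.
elim/tens_ind: y => [a' b'|c y y' IHy IHy']; last first.
  by rewrite mulrDr -scalerAr !hom2_act_linear comp_lfunDr -comp_lfunZr IHy IHy'.
apply/lfunP=> h; apply/lfunP=> v.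
rewrite talg_pureM comp_lfunE !hom2_act_pure actME; congr (act Y a (act Y a' (h _))).
exact: (@actME _ _ V).
Qed.

(* Hom_k(V, Y), with ((a (x) b) h)(v) = a h(v b). *)
Definition hom2 : fdmod L := FdMod hom2_act_linear hom2_act1 hom2_actM.

Lemma hom2E a b (h : 'Hom(V, Y)) v :
  (act hom2 (tpure a b : L) h : 'Hom(V, Y)) v = act Y a (h (act V b v)).
Proof. exact: hom2_act_pure. Qed.

End HomBimodule.

(** The elements with a = 1 play the part of v (x) x in V (x)_B X; they already span, because
    [tp_unit] moves a into X. *)
Definition tp V X (a : A) (v : V) (x : X) : outer_btens V X :=
  bpure (M := outer A V) (tpure a v) x.

Lemma tp_act V X a a' v x :
  act (outer_btens V X) a (@tp V X a' v x) = @tp V X (a * a') v x.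
Proof. by rewrite [LHS]outer_btens_actE tmap_pure id_lfunE lfunE. Qed.

Lemma tp_balanced V X a a' b v x :
  @tp V X a v (act X (tpure a' b : L) x) = @tp V X (a * a') (act V b v) x.
Proof. by rewrite /tp -bpure_balanced [act _ _ _]outer_act_pure. Qed.

Lemma tp_act1 V X a v x : @tp V X a v x = act (outer_btens V X) a (@tp V X 1 v x).
Proof. by rewrite tp_act mulr1. Qed.

Lemma tp_unit V X a v x : @tp V X a v x = @tp V X 1 v (act X (tpure a 1 : L) x).
Proof. by rewrite tp_balanced mul1r (@act1E _ _ V). Qed.

Lemma tp_linear V X a v : linear (@tp V X a v).
Proof. by have [br _] := bpure_bilinear (outer A V) X; exact: br. Qed.

Lemma tp_linearV V X a x : linear (fun v => @tp V X a v x).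
Proof.
have [_ bl] := bpure_bilinear (outer A V) X; have [pr _] := tpure_bilinear A V.
by move=> c v w; rewrite /tp pr; exact: bl.
Qed.

Lemma tp_uniq V X (U : vectType k) (f g : 'Hom(outer_btens V X, U)) :
  (forall v x, f (@tp V X 1 v x) = g (@tp V X 1 v x)) -> f = g.
Proof.
move=> fg; apply: btens_uniq => t x.
elim/tens_ind: t => [a v|c t t' IHt IHt']; first by have := fg v (act X (tpure a 1 : L) x); rewrite -tp_unit.
have [_ bl] := bpure_bilinear (outer A V) X.
by rewrite bl !linearP /= IHt IHt'.
Qed.

(** The universal property of V (x)_B X: balance over B suffices, the factor A being absorbed into
    X. *)
Lemma tp_lift V X (U : vectType k) (F : 'Hom(X, 'Hom(V, U))) :
    (forall b x v, F (act X (tpure 1 b : L) x) v = F x (act V b v)) ->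
  exists g : 'Hom(outer_btens V X, U), forall v x, g (@tp V X 1 v x) = F x v.
Proof.
move=> F_bal.
pose f0 x a v := F (act X (tpure a 1 : L) x) v.
have f0_bil x : bilinear_map (f0 x).
  split=> [a|v] c y z; rewrite /f0; first exact: linearP.
  have [_ pl] := tpure_bilinear A B.
  by rewrite pl act_linear add_lfunE scale_lfunE linearP add_lfunE scale_lfunE.
have [||g gE] := @btens_lift k L (outer A V) X U (fun t x => tlift (f0 x) t).
- split=> [t|x] c y z; last exact: linearP.
  elim/tens_ind: t => [a v|c' t t' IHt IHt'].
    by rewrite !tlift_pure // /f0 !linearP add_lfunE scale_lfunE.
  by rewrite !linearP /= IHt IHt' !scalerDr !scalerA addrACA mulrC -scalerA.
- move=> r t x; elim/tens_ind: r => [a b|c r r' IHr IHr']; last first.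
    rewrite (@act_linear _ _ (outer A V)) act_linear !add_lfunE !scale_lfunE linearP /=.
    rewrite IHr IHr'; elim/tens_ind: t {IHr IHr'} => [a v|c' t t' IHt IHt'].
      by rewrite !tlift_pure // /f0 !linearP add_lfunE scale_lfunE.
    by rewrite !linearP /= -IHt -IHt' !scalerDr !scalerA addrACA mulrC -scalerA.
  elim/tens_ind: t => [a' v|c t t' IHt IHt']; last by rewrite !linearP /= IHt IHt'.
  rewrite [act _ _ _]outer_act_pure !tlift_pure // /f0 -F_bal -!actME !talg_pureM.
  by rewrite !mulr1 !mul1r.
exists g => v x; rewrite /tp gE tlift_pure // /f0; congr (F _ v).
exact: act1E.
Qed.

Definition tpmap V X Z (f : 'Hom(X, Z)) : 'Hom(outer_btens V X, outer_btens V Z) :=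
  bmap (M := outer A V) (M' := outer A V) \1 f.

Lemma tpmapE V X Z (f : 'Hom(X, Z)) a v x :
  modhom f -> tpmap V f (@tp V X a v x) = @tp V Z a v (f x).
Proof.
move=> f_hom; rewrite /tpmap /tp bmap_pure // ?id_lfunE //.
by move=> r y; rewrite !id_lfunE.
Qed.

Lemma tp_hom V X Y (f : 'Hom(outer_btens V X, Y)) :
    (forall a v x, f (@tp V X a v x) = act Y a (f (@tp V X 1 v x))) ->
  @modhom k A (outer_btens V X) Y f.
Proof.
move=> fE a; suff /lfunP fa : (f \o act (outer_btens V X) a = act Y a \o f)%VF.
  by move=> t; have := fa t; rewrite !comp_lfunE.
by apply: tp_uniq => v x; rewrite comp_lfunE [RHS]comp_lfunE -tp_act1 fE.
Qed.

Lemma tpmap_hom V X Z (f : 'Hom(X, Z)) :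
  modhom f -> @modhom k A (outer_btens V X) (outer_btens V Z) (tpmap V f).
Proof.
move=> f_hom; apply: tp_hom => a v x.
by rewrite tpmapE // [X in act _ _ X]tpmapE // -tp_act1.
Qed.

Lemma tp_curry V X Y (f : 'Hom(outer_btens V X, Y)) :
    @modhom k A (outer_btens V X) Y f ->
  exists2 F : 'Hom(X, hom2 V Y), modhom F &
    forall x v, (F x : 'Hom(V, Y)) v = f (@tp V X 1 v x).
Proof.
move=> f_hom; pose F0 x : 'Hom(V, Y) := linfun (fun v => f (@tp V X 1 v x)).
have F0E x v : F0 x v = f (@tp V X 1 v x).
  by apply: linfun_linE => c u w; rewrite tp_linearV linearP.
have F_lin : linear F0.
  by move=> c x y; apply/lfunP=> v; rewrite add_lfunE scale_lfunE !F0E tp_linear linearP.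
exists (linfun F0 : 'Hom(X, hom2 V Y)); last by move=> x v; rewrite linfun_linE.
apply: modhom_pure => a b x; rewrite !linfun_linE //; apply/lfunP=> v.
apply/esym; apply: etrans (hom2E _ _ _ _) _.
by rewrite !F0E tp_balanced mul1r -f_hom -tp_act1.
Qed.

Lemma tp_uncurry V X Y (F : 'Hom(X, hom2 V Y)) : modhom F ->
  exists2 f : 'Hom(outer_btens V X, Y), @modhom k A (outer_btens V X) Y f &
    forall v x, f (@tp V X 1 v x) = (F x : 'Hom(V, Y)) v.
Proof.
move=> F_hom; have [b x v|f fE] := @tp_lift V X Y F.
  by rewrite F_hom; apply: etrans (hom2E _ _ _ _) _; rewrite act1E.
exists f => //; apply: tp_hom => a v x.
rewrite tp_unit !fE F_hom; apply: etrans (hom2E _ _ _ _) _.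
by rewrite (@act1E _ _ V).
Qed.

Lemma tp_extends V X Z (i : 'Hom(X, Z)) Y : modhom i ->
  (extends (tpmap V i : 'Hom(outer_btens V X, outer_btens V Z)) Y <->
   extends i (hom2 V Y)).
Proof.
move=> i_hom; split=> ext f f_hom.
  have [g g_hom gE] := tp_uncurry f_hom.
  have [h h_hom hE] := ext g g_hom.
  have [h' h'_hom h'E] := tp_curry h_hom.
  exists h' => // x; apply/lfunP=> v.
  by apply: etrans (h'E _ _) _; rewrite -gE -hE tpmapE.
have [g g_hom gE] := tp_curry f_hom.
have [h h_hom hE] := ext g g_hom.
have [h' h'_hom h'E] := tp_uncurry h_hom.
exists h' => // t; suff /lfunP/(_ t) : (h' \o tpmap V i)%VF = f by rewrite comp_lfunE.
by apply: tp_uniq => v x; rewrite comp_lfunE tpmapE // h'E hE gE.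
Qed.

(** V (x)_B - is left adjoint to Hom_k(V, -), which preserves surjections. *)
Lemma tp_proj V X : projective_mod X -> projective_mod (outer_btens V X).
Proof.
move=> X_proj; apply: projI => M N p f p_hom f_hom p_sur.
have [F F_hom FE] := tp_curry f_hom.
have P_hom : @modhom k L (hom2 V M) (hom2 V N) (postcomp V p).
  apply: modhom_pure => a b h; rewrite !postcompE; apply/lfunP=> v.
  rewrite comp_lfunE; apply/esym; apply: etrans (hom2E _ _ _ _) _; rewrite comp_lfunE -p_hom.
  by congr (p _); apply/esym/hom2E.
have [h|G G_hom GE] := proj_lift X_proj P_hom F_hom.
  exists (p^-1 \o h)%VF; rewrite postcompE; apply/lfunP=> v.
  by rewrite !comp_lfunE limg_lfunV.
have [g g_hom gE] := tp_uncurry G_hom.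
exists g => // t; suff /lfunP/(_ t) : (p \o g)%VF = f by rewrite comp_lfunE.
apply: tp_uniq => v x; rewrite comp_lfunE gE -FE -GE.
by rewrite postcompE comp_lfunE.
Qed.

(** For f merely B-linear, g is merely k-linear; this is enough to transport a splitting over B. *)
Lemma tp_functor V X Z (f : 'Hom(X, Z)) : @modhom k B (res X) (res Z) f ->
  exists g : 'Hom(outer_btens V X, outer_btens V Z),
    forall v x, g (@tp V X 1 v x) = @tp V Z 1 v (f x).
Proof.
move=> f_hom; pose F x : 'Hom(V, outer_btens V Z) := linfun (fun v => @tp V Z 1 v (f x)).
have FE x v : F x v = @tp V Z 1 v (f x).
  by apply: linfun_linE; exact: tp_linearV.
have F_lin : linear F.
  by move=> c x y; apply/lfunP=> v; rewrite add_lfunE scale_lfunE !FE linearP tp_linear.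
have [b x v|g gE] := @tp_lift V X (outer_btens V Z) (linfun F).
  by rewrite !(linfun_linE F_lin) !FE -resE f_hom resE tp_balanced mulr1.
by exists g => v x; rewrite gE (linfun_linE F_lin).
Qed.

(** The sequence splits over B, so its image under V (x)_B - splits over k and is therefore
    exact. *)
Lemma tp_ses V (X Y0 Z : fdmod L) (i : 'Hom(X, Y0)) (p : 'Hom(Y0, Z)) :
    ses i p -> projective_mod (res Z) ->
  @ses k A (outer_btens V X) (outer_btens V Y0) (outer_btens V Z) (tpmap V i) (tpmap V p).
Proof.
move=> S Z_proj; have [s [r [s_hom r_hom sE rE dec]]] := ses_split (res_ses S) Z_proj.
have [ih ph _ pi _ _] := S.
have [s' s'E] := tp_functor V s_hom; have [r' r'E] := tp_functor V r_hom.
have r'i t : r' (tpmap V i t) = t.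
  suff /lfunP/(_ t) : (r' \o tpmap V i)%VF = \1%VF by rewrite comp_lfunE id_lfunE.
  by apply: tp_uniq => v x; rewrite comp_lfunE tpmapE // r'E rE id_lfunE.
have ps' t : tpmap V p (s' t) = t.
  suff /lfunP/(_ t) : (tpmap V p \o s')%VF = \1%VF by rewrite comp_lfunE id_lfunE.
  by apply: tp_uniq => v x; rewrite comp_lfunE s'E tpmapE // sE id_lfunE.
have dec' t : t = tpmap V i (r' t) + s' (tpmap V p t).
  suff /lfunP/(_ t) : ((tpmap V i \o r') + (s' \o tpmap V p))%VF = \1%VF.
    by rewrite add_lfunE comp_lfunE [X in _ + X]comp_lfunE id_lfunE.
  apply: tp_uniq => v x; rewrite add_lfunE comp_lfunE [X in _ + X]comp_lfunE.
  rewrite r'E tpmapE // [X in s' X]tpmapE // s'E id_lfunE.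
  rewrite [in RHS](dec x) -[X in X + _]scale1r -[i _ + _]scale1r.
  by have := tp_linear (V := V) (X := Y0) 1 v 1 (i (r x)) (s (p x)); rewrite !scale1r => ->.
split=> [||t it0|t|t pt0|t].
- exact: tpmap_hom.
- exact: tpmap_hom.
- by rewrite -[t]r'i it0 linear0.
- suff /lfunP/(_ t) : (tpmap V p \o tpmap V i)%VF = 0 by rewrite comp_lfunE zero_lfunE.
  apply: tp_uniq => v x; rewrite comp_lfunE [X in tpmap _ _ X]tpmapE // tpmapE // pi zero_lfunE.
  by have := tp_linear (V := V) (X := Z) 1 v (-1) 0 0; rewrite addr0 scaler0 scaleN1r addNr.
- by exists (r' t); rewrite {1}[t]dec' pt0 linear0 addr0.
- by exists (s' t).
Qed.

End OuterProduct.

(** * Mon(B, A) and projectivity over B *)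

Section Devissage.
Variables (k : fieldType) (R : falgType k).
Implicit Types C E G I K L M N P Q X Y Z : fdmod R.

Lemma extends_ses K Q (i : 'Hom(K, Q)) X Y Z (j : 'Hom(X, Y)) (q : 'Hom(Y, Z)) :
    modhom i -> projective_mod Q -> ses j q -> extends i X -> extends i Z ->
  extends i Y.
Proof.
move=> i_hom Q_proj [jh qh jinj qj jex qsur] X_ext Z_ext f f_hom.
have [h h_hom hE] := Z_ext _ (modhom_comp f_hom qh).
have [h' h'_hom h'E] := proj_lift Q_proj qh h_hom qsur.
have [x|f' f'_hom f'E] := factor_inj jh (modhomB f_hom (modhom_comp i_hom h'_hom)) jinj.
  by apply: jex; rewrite add_lfunE opp_lfunE comp_lfunE linearB /= h'E hE comp_lfunE subrr.
have [g g_hom gE] := X_ext _ f'_hom.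
exists (h' + (j \o g))%VF; first exact: modhomD h'_hom (modhom_comp g_hom jh).
move=> x; rewrite add_lfunE comp_lfunE gE f'E add_lfunE opp_lfunE comp_lfunE.
by rewrite addrC subrK.
Qed.

(** Induction on dimension: a nonzero proper submodule presents Y as an extension of smaller
    modules, and [extends_ses] applies because Q is projective. *)
Lemma extends_of_simple K Q (i : 'Hom(K, Q)) :
    modhom i -> projective_mod Q -> (forall S, simple_mod S -> extends i S) ->
  forall Y, extends i Y.
Proof.
move=> i_hom Q_proj i_simple Y; move: {2}(dim Y).+1 (ltnSn (dim Y)) => n.
elim: n Y => // n IHn Y; rewrite ltnS => Yn.
have [Y0|Y_neq0] := classic (zero_mod Y).
  move=> f _; exists 0; first exact: modhom0.
  by move=> x; rewrite zero_lfunE; apply/esym; apply: (zero_modP Y).1 Y0 _.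
have [[U [U_stable U_neq0 U_neqT]]|no_sub] := classic (exists U : {vspace Y},
    [/\ forall r, (act Y r @: U <= U)%VS, U <> 0%VS & U <> fullv]); last first.
  apply: i_simple; split=> // U U_stable; apply: NNPP => U_nontriv.
  by case: no_sub; exists U; split=> // UE; apply: U_nontriv; [left | right].
have stable r x : x \in U -> act Y r x \in U.
  by move=> Ux; apply: (subvP (U_stable r)); apply: memv_img.
have q_hom := qproj_hom stable; set q := qproj U in q_hom.
have Ys := ses_ker q_hom (@qproj_onto _ _ _ _ stable).
have dimU : (\dim U < dim Y)%N.
  rewrite ltn_neqAle -{2}dimvf dimvS ?subvf // andbT; apply/eqP=> dUE.
  by apply/U_neqT/eqP; rewrite eqEdim subvf dimvf dUE leqnn.
have dimU0 : (0 < \dim U)%N by rewrite lt0n dimv_eq0; apply/eqP.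
have Z_ext : extends i (quot_mod stable).
  have dimZ : dim (quot_mod stable) = \dim (U^C)%VS by [].
  by apply: IHn; rewrite dimZ dimv_compl dimvf (leq_trans _ Yn) // ltn_subrL dimU0 (leq_trans _ dimU).
have K_ext : extends i (ker_mod q_hom).
  have dimK : dim (ker_mod q_hom) = \dim (lker q) by [].
  by apply: IHn; rewrite dimK qproj_ker (leq_trans dimU).
exact: extends_ses i_hom Q_proj Ys K_ext Z_ext.
Qed.

End Devissage.

Section MonProjective.
Variables (k : fieldType) (A B : falgType k).
Local Notation L := (talg A B).
Implicit Types (X Z : fdmod L) (V : rmod B) (Y : fdmod A).

Lemma tpmap_comp V X Z (X' : fdmod L) (f : 'Hom(X, X')) (g : 'Hom(X', Z)) (h : 'Hom(X, Z)) :
    modhom f -> modhom g -> (forall x, g (f x) = h x) ->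
  forall t, tpmap V h t = tpmap V g (tpmap V f t).
Proof.
move=> f_hom g_hom gf t.
have h_hom : modhom h by move=> r x; rewrite -!gf f_hom g_hom.
suff /lfunP/(_ t) : tpmap V h = (tpmap V g \o tpmap V f)%VF by rewrite comp_lfunE.
by apply: tp_uniq => v x; rewrite comp_lfunE tpmapE // [X in tpmap _ _ X]tpmapE // tpmapE // gf.
Qed.

(** All kernels in the resolution are B-projective along with X, so each short exact piece stays
    exact under V (x)_B -. *)
Lemma tpmap_resolution V X (P : nat -> fdmod L) (d : forall n, 'Hom(P n.+1, P n))
    (e : 'Hom(P 0, X)) j :
    proj_resolution d e -> projective_mod (res X) ->
  limg (tpmap V (d j.+1)) = lker (tpmap V (d j)).
Proof.
elim: j X P d e => [|j IHj] X P d e resX X_proj; have P_proj n := res_proj (@pres_proj _ _ _ _ _ _ resX n).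
  have [K [i [e' [Xs e'E resK]]]] := proj_resolution_shift resX.
  have K_proj := ses_proj_ker (res_ses Xs) X_proj (P_proj 0).
  have [K' [i' [e'' [Ks e''E resK']]]] := proj_resolution_shift resK.
  have K'_proj := ses_proj_ker (res_ses Ks) K_proj (P_proj 1).
  have [K'' [i'' [_ [K's _ _]]]] := proj_resolution_shift resK'.
  have [_ _ inj0 _ _ _] := tp_ses V Xs X_proj.
  have [_ _ _ pi1 ex1 _] := tp_ses V Ks K_proj.
  have [_ _ _ _ _ sur2] := tp_ses V K's K'_proj.
  have d0E := tpmap_comp (V := V) (pres_aug resK) (ses_i Xs) e'E.
  have d1E := tpmap_comp (V := V) (pres_aug resK') (ses_i Ks) e''E.
  apply/limg_lkerP; split=> [t|t]; rewrite d0E; first by rewrite d1E pi1 linear0.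
  move=> /inj0/ex1[u ->]; have [w <-] := sur2 u.
  by exists w; rewrite d1E.
have [K [i [e' [Xs _ resK]]]] := proj_resolution_shift resX.
apply: (IHj K (fun m => P m.+1) (fun m => d m.+1) e' resK).
exact: ses_proj_ker (res_ses Xs) X_proj (P_proj 0).
Qed.

(** Together with [tp_dual_curry], the duality Hom_B(X, S) = D(DS (x)_B X), which turns exactness
    after DS (x)_B - into extension problems with values in S. *)
Lemma tp_dual_uncurry (S : fdmod B) X (f : 'Hom(X, S)) : @modhom k B (res X) S f ->
  exists phi : 'Hom(outer_btens (dual S) X, k^o),
    forall (v : 'Hom(S, k^o)) x, phi (@tp _ _ _ (dual S) X 1 v x) = v (f x).
Proof.
move=> f_hom; pose V : rmod B := dual S.
pose F x : 'Hom(V, k^o) := linfun (fun v : 'Hom(S, k^o) => v (f x)).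
have FE x v : F x v = (v : 'Hom(S, k^o)) (f x).
  by apply: linfun_linE => c u w; rewrite add_lfunE scale_lfunE.
have F_lin : linear F.
  by move=> c x y; apply/lfunP=> v; rewrite add_lfunE scale_lfunE !FE !linearP.
have [b x v|phi phiE] := @tp_lift k A B V X k^o (linfun F).
  rewrite !(linfun_linE F_lin) !FE -resE f_hom; apply/esym.
  exact: dual_modE.
by exists phi => v x; rewrite phiE (linfun_linE F_lin) FE.
Qed.

Lemma tp_dual_curry (S : fdmod B) X (phi : 'Hom(outer_btens (dual S) X, k^o)) :
  exists2 g : 'Hom(X, S), @modhom k B (res X) S g &
    forall x (v : 'Hom(S, k^o)), v (g x) = phi (@tp _ _ _ (dual S) X 1 v x).
Proof.
pose V : rmod B := dual S.
pose H x : 'Hom(V, k^o) := linfun (fun v : V => phi (tp 1 v x)).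
have HE x v : H x v = phi (tp 1 v x).
  by apply: linfun_linE => c u w; rewrite tp_linearV linearP.
have H_lin : linear H.
  by move=> c x y; apply/lfunP=> v; rewrite add_lfunE scale_lfunE !HE tp_linear linearP.
have [g gE] := undual (linfun H : 'Hom(X, 'Hom('Hom(S, k^o), k^o))).
have {}gE x (v : 'Hom(S, k^o)) : v (g x) = phi (tp 1 (v : V) x).
  by rewrite gE (linfun_linE H_lin); apply: HE.
exists g => // b x; apply: functional_inj => v.
by rewrite gE resE tp_balanced mulr1 -gE; exact: dual_modE.
Qed.

Lemma Mon_res_proj X : Mon X <-> projective_mod (res X).
Proof.
split=> [X_Mon | X_proj S _ [//|j] _ P d e resX]; last first.
  exact: (tpmap_resolution (dual S) j resX X_proj).
have [P [d [e resX]]] := proj_resolution_exists X.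
have [K [i [e' [Xs e'E resK]]]] := proj_resolution_shift resX.
have [ih eh iinj ei iex esur] := Xs.
have P0_proj := res_proj (@pres_proj _ _ _ _ _ _ resX 0).
have Xs' := res_ses Xs; have [K0 [i0 [e0 [Ks e0E _]]]] := proj_resolution_shift resK.
suff i_ext (Y0 : fdmod B) : @extends k B (res K) (res (P 0)) i Y0.
  (* Extending the identity of K gives a B-linear retraction of K -> P 0, so X is a direct summand
     of P 0 over B. *)
  have [r r_hom rE] := i_ext _ _ (@modhom_id k B (res K)).
  by apply: (ses_proj_coker Xs' r_hom) P0_proj => x; rewrite rE id_lfunE.
apply: extends_of_simple Y0 => [||S S_simple f f_hom]; [exact: ses_i Xs' | by [] |].
have /limg_lkerP[_ ex] := X_Mon S S_simple 1%N isT P d e resX.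
have f_hom' := modhom_comp (res_hom (pres_aug resK)) f_hom.
have [phi phiE] := tp_dual_uncurry f_hom'.
(* The functional phi corresponds to f e'. It vanishes on the kernel of DS (x) d 0, which is the
   image of DS (x) d 1, as e' kills the image of d 1. Hence it comes from a functional psi, that is,
   from a map P 0 -> S. *)
have [t dt0|psi psiE] := linear_factor (p := tpmap (dual S) (d 0)) (f := phi).
  have [u ->] := ex t dt0.
  suff /lfunP/(_ u) : (phi \o tpmap (dual S) (d 1))%VF = 0 by rewrite comp_lfunE zero_lfunE.
  apply: tp_uniq => v x; rewrite comp_lfunE tpmapE; last exact: (pres_hom resX).
  by rewrite phiE zero_lfunE -(e0E x) comp_lfunE (ses_pi Ks) !linear0.
have [g g_hom gE] := tp_dual_curry psi.
exists g => // z; apply: functional_inj => v.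
have [y <-] := ses_sur Ks z; rewrite gE e'E.
have := psiE (@tp _ _ _ (dual S) (P 1) 1 v y); rewrite tpmapE; last exact: (pres_hom resX).
by rewrite phiE comp_lfunE.
Qed.

End MonProjective.

(** * The modules A (x) W *)

Section TensorModule.
Variables (k : fieldType) (A B : falgType k).
Local Notation L := (talg A B).
Implicit Types (X : fdmod L) (W : fdmod B) (V : rmod B).

Section TensorDef.
Variable W : fdmod B.

Definition tmod_act (x : L) : 'End(tens A W) :=
  tlift (fun (a : A) (b : B) => tmap (amull a) (act W b)) x.

Lemma tmod_act_pure a b a' w :
  tmod_act (tpure a b) (tpure a' w) = tpure (a * a') (act W b w).
Proof.
have [pr pl] := tmap_bilinear A A W W.
rewrite /tmod_act tlift_pure; first by rewrite tmap_pure lfunE.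
by split=> [u|u] c x y; [rewrite act_linear pr | rewrite linearP pl].
Qed.

Fact tmod_act_linear : linear tmod_act.
Proof. by move=> c x y; rewrite /tmod_act linearP. Qed.

Fact tmod_act1 : tmod_act 1 = \1%VF.
Proof. by apply: tlift_uniq => a w; rewrite tmod_act_pure mul1r act1 !id_lfunE. Qed.

Fact tmod_actM (x y : L) : tmod_act (x * y) = (tmod_act x \o tmod_act y)%VF.
Proof.
elim/tens_ind: x => [a b|c x x' IHx IHx']; last first.
  by rewrite mulrDl -scalerAl !tmod_act_linear comp_lfunDl -comp_lfunZl IHx IHx'.
elim/tens_ind: y => [a' b'|c y y' IHy IHy']; last first.
  by rewrite mulrDr -scalerAr !tmod_act_linear comp_lfunDr -comp_lfunZr IHy IHy'.
apply: tlift_uniq => a'' w.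
by rewrite talg_pureM comp_lfunE !tmod_act_pure actME mulrA.
Qed.

Definition tmod : fdmod L := FdMod tmod_act_linear tmod_act1 tmod_actM.

Lemma tmodE a b a' w :
  act tmod (tpure a b : L) (tpure a' w) = tpure (a * a') (act W b w).
Proof. exact: tmod_act_pure. Qed.

Definition tmod_in : 'Hom(W, tmod) := linfun (fun w : W => tpure (1 : A) w).

Lemma tmod_inE w : tmod_in w = tpure 1 w.
Proof. by apply: linfun_linE; have [pr _] := tpure_bilinear A W; exact: pr. Qed.

Lemma tmod_in_hom : @modhom k B W (res tmod) tmod_in.
Proof. by move=> b w; rewrite !tmod_inE resE tmodE mulr1. Qed.

Lemma tmod_pure a w : tpure a w = act tmod (tpure a 1 : L) (tmod_in w).
Proof. by rewrite tmod_inE tmodE mulr1 act1E. Qed.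

Lemma tmod_uniq X (f g : 'Hom(tmod, X)) : modhom f -> modhom g ->
  (forall w, f (tmod_in w) = g (tmod_in w)) -> f = g.
Proof.
by move=> f_hom g_hom fg; apply: tlift_uniq => a w; rewrite tmod_pure f_hom g_hom fg.
Qed.

(** A (x) - is left adjoint to [res], with unit [tmod_in]. *)
Lemma tmod_lift X (f : 'Hom(W, X)) : @modhom k B W (res X) f ->
  exists2 g : 'Hom(tmod, X), modhom g & forall w, g (tmod_in w) = f w.
Proof.
move=> f_hom; pose g0 a w := act X (tpure a 1 : L) (f w).
have g0_bil : bilinear_map g0.
  split=> [a|w] c x y; rewrite /g0; first by rewrite !linearP.
  by have [_ pl] := tpure_bilinear A B; rewrite pl act_linear add_lfunE scale_lfunE.
have gE a w : tlift g0 (tpure a w) = act X (tpure a 1 : L) (f w) by rewrite tlift_pure.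
exists (tlift g0); last by move=> w; rewrite tmod_inE gE; apply: act1E.
apply: modhom_pure => a b t; elim/tens_ind: t => [a' w|c x y IHx IHy].
  by rewrite tmodE !gE f_hom resE -!actME !talg_pureM !mulr1 !mul1r.
by rewrite !linearP /= IHx IHy.
Qed.

End TensorDef.

Lemma tmod_proj W : projective_mod W -> projective_mod (tmod W).
Proof.
move=> W_proj; apply: projI => M N p f p_hom f_hom p_sur.
have fi_hom := modhom_comp (@tmod_in_hom W) (res_hom f_hom).
have [g g_hom gE] := proj_lift W_proj (res_hom p_hom) fi_hom p_sur.
have [h h_hom hE] := tmod_lift g_hom.
exists h => // t; suff /lfunP/(_ t) : (p \o h)%VF = f by rewrite comp_lfunE.
apply: tmod_uniq => //; first exact: modhom_comp.
by move=> w; rewrite comp_lfunE hE gE comp_lfunE.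
Qed.

Definition tmod_map W (W' : fdmod B) (f : 'Hom(W, W')) : 'Hom(tmod W, tmod W') := tmap \1 f.

Lemma tmod_mapE W (W' : fdmod B) (f : 'Hom(W, W')) a w :
  tmod_map f (tpure a w) = tpure a (f w).
Proof. by rewrite [LHS]tmap_pure id_lfunE. Qed.

Lemma tmod_map_in W (W' : fdmod B) (f : 'Hom(W, W')) w :
  tmod_map f (tmod_in W w) = tmod_in W' (f w).
Proof. by rewrite !tmod_inE tmod_mapE. Qed.

Lemma tmod_map_hom W (W' : fdmod B) (f : 'Hom(W, W')) : modhom f -> modhom (tmod_map f).
Proof.
move=> f_hom; apply: modhom_pure => a b t.
elim/tens_ind: t => [a' w|c x y IHx IHy]; first by rewrite tmodE !tmod_mapE tmodE f_hom.
by rewrite !linearP /= IHx IHy.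
Qed.

(** The sequence splits over k by [p^-1] and r, and A (x) - carries the splitting along. *)
Lemma tmod_ses (W1 W2 W3 : fdmod B) (i : 'Hom(W1, W2)) (p : 'Hom(W2, W3)) :
  ses i p -> ses (tmod_map i) (tmod_map p).
Proof.
case=> ih ph iinj pi iex psur.
have psE z : p (p^-1%VF z) = z by apply: limg_lfunV.
pose r : 'Hom(W2, W1) := (i^-1 \o (\1 - (p^-1 \o p)))%VF.
have rE y : i (r y) = y - p^-1%VF (p y).
  rewrite comp_lfunE limg_lfunV; last first.
    rewrite add_lfunE opp_lfunE comp_lfunE id_lfunE.
    have [|x ->] := iex (y - p^-1%VF (p y)); last by exists x.
    by rewrite linearB /= psE subrr.
  by rewrite add_lfunE opp_lfunE comp_lfunE id_lfunE.
have ri x : r (i x) = x.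
  apply/eqP; rewrite -subr_eq0; apply/eqP/iinj.
  by rewrite linearB /= rE pi linear0 subr0 subrr.
have tri t : tmod_map r (tmod_map i t) = t.
  by elim/tens_ind: t => [a w|c x y IHx IHy]; rewrite ?tmod_mapE ?ri // !linearP /= IHx IHy.
have tps t : tmod_map p (tmod_map (p^-1)%VF t) = t.
  by elim/tens_ind: t => [a w|c x y IHx IHy]; rewrite ?tmod_mapE ?psE // !linearP /= IHx IHy.
have tpi t : tmod_map p (tmod_map i t) = 0.
  elim/tens_ind: t => [a w|c x y IHx IHy]; last by rewrite !linearP /= IHx IHy scaler0 addr0.
  rewrite !tmod_mapE pi; have [pr _] := tpure_bilinear A W3.
  by have := pr a (-1) 0 0; rewrite addr0 scaler0 scaleN1r addNr.
have tdec t : t = tmod_map i (tmod_map r t) + tmod_map (p^-1)%VF (tmod_map p t).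
  elim/tens_ind: t => [a w|c x y IHx IHy]; last by rewrite {1}IHx {1}IHy !linearP /= scalerDr addrACA.
  rewrite !tmod_mapE rE; have [pr _] := tpure_bilinear A W2.
  have := pr a 1 (w - p^-1%VF (p w)) (p^-1%VF (p w)).
  by rewrite !scale1r subrK.
split=> [||t it0|t|t pt0|t].
- exact: tmod_map_hom.
- exact: tmod_map_hom.
- by rewrite -[t]tri it0 linear0.
- exact: tpi.
- by exists (tmod_map r t); rewrite {1}[t]tdec pt0 linear0 addr0.
- by exists (tmod_map (p^-1)%VF t).
Qed.

Lemma tmod_pdim n W : pdim n W -> pdim n (tmod W).
Proof.
elim: n W => [|n IHn] W; first exact: tmod_proj.
case=> K [P [i [p [P_proj Ws /IHn K_n]]]].
exists (tmod K), (tmod P), (tmod_map i), (tmod_map p); split=> //.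
  exact: tmod_proj.
exact: tmod_ses.
Qed.

Lemma tmod_reg : isom (regmod L) (tmod (regmod B)).
Proof.
have hom (f : 'End(tens A B)) : f = \1%VF ->
    @modhom k L (regmod L) (tmod (regmod B)) f /\ @modhom k L (tmod (regmod B)) (regmod L) f.
  move=> ->; have actE (x y : tens A B) :
      act (regmod L) x y = act (tmod (regmod B)) x y by rewrite lfunE.
  by split=> r x; rewrite !id_lfunE; [exact: actE | exact: esym (actE _ _)].
have [f_hom g_hom] := hom _ erefl.
by exists \1%VF, \1%VF; split=> // x; rewrite !id_lfunE.
Qed.

Lemma isom_dual2 W : isom W (codual (dual W)).
Proof.
pose s w : 'Hom(dual W, k^o) := linfun (fun h : 'Hom(W, k^o) => h w).
have sE w (h : 'Hom(W, k^o)) : s w h = h w.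
  by apply: linfun_linE => c f g; rewrite add_lfunE scale_lfunE.
have s_lin : linear s.
  by move=> c x y; apply/lfunP=> h; rewrite add_lfunE scale_lfunE !sE linearP.
have s_hom : @modhom k B W (codual (dual W)) (linfun s).
  move=> b w; apply/lfunP=> h; rewrite linfun_linE // sE.
  apply/esym; apply: etrans (codual_modE _ _ _) _.
  by rewrite linfun_linE // sE; exact: dual_modE.
have [r rE] := @undual k W (codual (dual W)) \1%VF.
have sK w : r (linfun s w) = w.
  by apply: functional_inj => h; rewrite rE id_lfunE linfun_linE // sE.
have rK u : linfun s (r u) = u.
  by apply/lfunP=> h; rewrite linfun_linE // sE rE id_lfunE.
exists (linfun s), r; split=> //.
by move=> b u; rewrite -[u in LHS]rK -s_hom sK.
Qed.

(** Stated up to an isomorphism of W with DV, as it serves both W = DV and a given W with V = DW.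
    The map sends a (x) w to v |-> w(v) a; its inverse is the sum over a basis e_i of V of h(e_i)
    (x) e_i^*. *)
Lemma tmod_hom2 W V : isom W (codual V) -> isom (tmod W) (hom2 V (regmod A)).
Proof.
case=> th [th' [th_hom th'_hom thK th'K]].
pose F0 w : 'Hom(V, A) := linfun (fun v => (th w : 'Hom(V, k^o)) v *: (1 : A)).
have F0E w v : F0 w v = (th w : 'Hom(V, k^o)) v *: (1 : A).
  by apply: linfun_linE => c x y; rewrite linearP scalerDl scalerA.
have F_lin : linear F0.
  move=> c x y; apply/lfunP=> v; rewrite add_lfunE scale_lfunE !F0E linearP.
  by rewrite add_lfunE scale_lfunE scalerDl scalerA.
have F_hom : @modhom k B W (res (hom2 V (regmod A))) (linfun F0).
  move=> b w; rewrite !(linfun_linE F_lin); apply/lfunP=> v; rewrite resE.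
  apply/esym; apply: etrans (hom2E _ _ _ _) _; rewrite act1E !F0E th_hom.
  by congr (_ *: _); apply/esym; exact: codual_modE.
have [f f_hom fE] := tmod_lift F_hom.
have fpE a w v : (f (tpure a w) : 'Hom(V, A)) v = (th w : 'Hom(V, k^o)) v *: a.
  rewrite tmod_pure f_hom; apply: etrans (@hom2E k A B V (regmod A) _ _ _ _) _.
  rewrite fE (linfun_linE F_lin) F0E (@act1E _ _ V) regmod_actE.
  by rewrite -scalerAr mulr1.
pose g0 (h : 'Hom(V, A)) : tens A W :=
  \sum_i tpure (h (tbase i)) (th' (vcoord (V := V) i)).
have [_ pl] := tpure_bilinear A W; have [pr _] := tpure_bilinear A W.
have g_lin : linear g0.
  move=> c x y; rewrite /g0 scaler_sumr -big_split; apply: eq_bigr => i _ /=.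
  by rewrite add_lfunE scale_lfunE pl.
have fgK h : f (g0 h) = h.
  apply/lfunP=> v; rewrite /g0 linear_sum sum_lfunE [in RHS](tbase_expand v) linear_sum.
  apply: eq_bigr => i _; have := fpE (h (tbase i)) (th' (vcoord (V := V) i)) v.
  by rewrite th'K vcoordE linearZ.
have gfK t : g0 (f t) = t.
  elim/tens_ind: t => [a w|c x y IHx IHy]; last by rewrite !linearP g_lin IHx IHy.
  have wE : w = \sum_i (th w : 'Hom(V, k^o)) (tbase i) *: th' (vcoord (V := V) i).
    rewrite -[LHS]thK [X in th' X](functional_expand (th w)) linear_sum.
    by apply: eq_bigr => i _; rewrite linearZ.
  rewrite /g0 [in RHS]wE (linear_comb (pr a)); apply: eq_bigr => i _.
  have := fpE a w (tbase i) => /= ->.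
  by apply/matrixP=> x y; rewrite !mxE linearZ mxE mulrA.
exists f, (linfun g0); split=> // [r h|t|h]; rewrite ?(linfun_linE g_lin) //.
by rewrite -[h in LHS]fgK -f_hom gfK.
Qed.

End TensorModule.

(** * The two inclusions and the converse *)

Section MainDirections.
Variables (k : fieldType) (A B : falgType k).
Local Notation L := (talg A B).
Implicit Types (X Z P : fdmod L) (W G : fdmod B) (V : rmod B) (Y : fdmod A).

Lemma reg_proj (R : falgType k) : projective_mod (regmod R).
Proof.
apply: projI => M N p f p_hom f_hom p_sur; have [m mE] := p_sur (f (1 : R)).
pose g0 (r : R) := act M r m.
have g_lin : linear g0 by move=> c r s; rewrite /g0 act_linear add_lfunE scale_lfunE.
have gE r : linfun g0 r = act M r m by rewrite linfun_linE.
exists (linfun g0) => [r x|x]; rewrite !gE; first by rewrite regmod_actE actME.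
by rewrite p_hom mE -f_hom regmod_actE mulr1.
Qed.

(** The modules A (x) G form a class closed under both steps of [Gproj_coind]. Its Ext condition
    holds because Ext^1_L(A (x) G, L) = Ext^1_B(G, L) by adjunction, and L is projective over B. *)
Lemma tmod_Gproj G : Gproj G -> Gproj (tmod A G).
Proof.
move=> G_Gproj; apply: (@Gproj_coind _ _ (fun X => exists2 G, Gproj G & X = tmod A G)); last by exists G.
move=> {G G_Gproj} _ [G /Gproj_unfold[ext [K K_Gproj KG] [G' G'_Gproj GG']] ->].
have syz W W' : is_syzygy W W' -> is_syzygy (tmod A W) (tmod A W').
  by case=> [[P i p P_proj S]]; apply: is_syzygyI (tmod_proj P_proj) (tmod_ses A S).
split; last 1 [by exists (tmod A K); [exists K | exact: syz]
              |by exists (tmod A G'); [exists G' | exact: syz]].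
case: KG => [[P i p P_proj S]].
apply: (ext1_of_ses (tmod_proj P_proj) (tmod_ses A S)) => f f_hom.
have res_reg : projective_mod (res (regmod L)) by exact/res_proj/reg_proj.
have [g g_hom gE] := ext1_proj ext res_reg P_proj S (modhom_comp (@tmod_in_hom _ A _ K) (res_hom f_hom)).
have [h h_hom hE] := tmod_lift g_hom.
have i_hom := tmod_map_hom (A := A) (ses_i S).
exists h => // t; suff /lfunP/(_ t) : (h \o tmod_map A i)%VF = f by rewrite comp_lfunE.
apply: tmod_uniq => //; first exact: modhom_comp.
by move=> w; rewrite comp_lfunE tmod_map_in hE gE comp_lfunE.
Qed.

(** For a linear form l on A with l 1 = 1, the map a (x) w |-> l(a) w is a B-linear retraction of w
    |-> 1 (x) w. *)
Lemma tmod_proj_inv W : projective_mod (res (tmod A W)) -> projective_mod W.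
Proof.
have [l l1] : exists l : 'Hom(A, k^o), l 1 = 1.
  have [l l1] : exists l : 'Hom(A, k^o), l 1 <> 0.
    apply: NNPP => l0; have /eqP[] := oner_neq0 A; apply: functional_sep => l.
    by apply: NNPP => l1; apply: l0; exists l.
  by exists ((l 1)^-1 *: l); rewrite scale_lfunE; apply: mulVf; apply/eqP.
pose r0 a w : W := (l a : k) *: w.
have r0_bil : bilinear_map r0.
  split=> [a|w] c x y; rewrite /r0; last by rewrite linearP scalerDl scalerA.
  by rewrite scalerDr !scalerA mulrC.
have rE a w : tlift r0 (tpure a w) = (l a : k) *: w by rewrite tlift_pure.
have r_hom : @modhom k B (res (tmod A W)) W (tlift r0).
  move=> b t; elim/tens_ind: t => [a w|c x y IHx IHy]; last by rewrite !linearP /= IHx IHy.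
  by rewrite resE tmodE !rE mul1r linearZ.
move=> tW_proj; apply: (proj_retract tW_proj (@tmod_in_hom _ A _ W) r_hom) => w.
by rewrite tmod_inE rE l1 scale1r.
Qed.

(** Membership in Mon(B, A-Gproj) with the Tor condition replaced through [Mon_res_proj]. *)
Definition Mon_Gproj X : Prop :=
  projective_mod (res X) /\ forall V, Gproj (outer_btens V X).

(** By adjunction this is Ext^1_A(V (x)_B X, A) = 0, computed from the free presentation of X, which
    V (x)_B - keeps exact. *)
Lemma Mon_ext_hom2 X V : Mon_Gproj X -> Ext1_eq0 X (hom2 V (regmod A)).
Proof.
case=> X_proj T_Gproj.
have X_free : projective_mod (free_mod L X) by exact: free_mod_projective.
apply: (ext1_of_ses X_free (ses_syz X)).
apply: (tp_extends _ _ (ses_i (ses_syz X))).1.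
have [ext _ _] := Gproj_unfold (T_Gproj V).
exact: ext (tp_proj (V := V) X_free) (tp_ses V (ses_syz X) X_proj).
Qed.

Lemma Mon_ext_tmod X W : Mon_Gproj X -> Ext1_eq0 X (tmod A W).
Proof.
move=> X_Mon; have [s [r [s_hom r_hom sK _]]] := tmod_hom2 A (isom_dual2 W).
exact: ext1_retract s_hom r_hom sK (@Mon_ext_hom2 _ _ X_Mon).
Qed.

Lemma Mon_approx_extends X P (i : 'Hom(X, P)) V :
    Mon_Gproj X -> modhom i -> extends i (regmod L) ->
  extends (tpmap V i : 'Hom(outer_btens V X, outer_btens V P)) (regmod A).
Proof.
move=> X_Mon i_hom i_ext; apply: (tp_extends _ _ i_hom).2.
have [s [r [s_hom r_hom sK rK]]] := tmod_hom2 A (isom_refl (codual V)); set W := codual V in s s_hom r r_hom sK rK.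
apply: (extends_retract r_hom s_hom rK) => f f_hom.
have Ws := tmod_ses A (ses_syz W).
(* The target A (x) DV need not be projective over L. The map is therefore lifted to A (x) F, which
   is projective, before it is extended along i. *)
have [g g_hom gE] := ext1_lift (@Mon_ext_tmod _ _ X_Mon) Ws f_hom.
have W_proj : projective_mod (tmod A (free_mod B W)) by exact/tmod_proj/free_mod_projective.
have [h h_hom hE] := extends_proj i_ext W_proj g_hom.
exists (tmod_map A (cover W) \o h)%VF; first exact: modhom_comp h_hom (ses_p Ws).
by move=> x; rewrite comp_lfunE hE gE.
Qed.

(** The module DX (x)_B X embeds in a projective A-module, so its approximation DX (x) i is
    injective. The functional phi corresponding to the identity of X then extends to DX (x)_B P, and
    the extension corresponds to the retraction. *)
Lemma Mon_approx_split X P (i : 'Hom(X, P)) :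
    Mon_Gproj X -> modhom i -> extends i (regmod L) ->
  exists2 r : 'Hom(P, X), @modhom k B (res P) (res X) r & forall x, r (i x) = x.
Proof.
move=> X_Mon i_hom i_ext; pose V := dual (res X).
have Ti_ext := Mon_approx_extends (V := V) X_Mon i_hom i_ext.
have [_ _ [C _ [[Q j q Q_proj S]]]] := Gproj_unfold (X_Mon.2 V).
have Ti_inj t : tpmap V i t = 0 -> t = 0.
  by move/(extends_mono (outer_btens V X) Ti_ext Q_proj (ses_i S))/(ses_inj S).
have [phi phiE] := tp_dual_uncurry (@modhom_id _ _ (res X)).
have [t /Ti_inj ->|psi psiE] := linear_factor (p := tpmap V i) (f := phi); first exact: linear0.
have [r r_hom rE] := tp_dual_curry psi.
exists r => // x; apply: functional_inj => v.
by rewrite rE; have := psiE (@tp _ _ _ V X 1 v x); rewrite tpmapE // phiE id_lfunE.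
Qed.

Lemma Mon_Gproj_Gproj X : Mon_Gproj X -> Gproj X.
Proof.
apply: (@Gproj_coind _ _ Mon_Gproj) => {}X X_Mon; have [X_proj T_Gproj] := X_Mon.
have X_free : projective_mod (free_mod L X) by exact: free_mod_projective.
split.
- have [s [r [s_hom r_hom sK _]]] := tmod_reg A B.
  exact: ext1_retract s_hom r_hom sK (@Mon_ext_tmod _ _ X_Mon).
- exists (syzygy X 1); last exact: is_syzygyI X_free (ses_syz X).
  split; first exact: ses_proj_ker (res_ses (ses_syz X)) X_proj (res_proj X_free).
  move=> V; apply: Gproj_syz (T_Gproj V) _.
  exact: is_syzygyI (tp_proj (V := V) X_free) (tp_ses V (ses_syz X) X_proj).
have [P [i [P_proj i_hom i_ext]]] := free_approx X.
have [r r_hom rE] := Mon_approx_split X_Mon i_hom i_ext.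
have i_inj x : i x = 0 -> x = 0 by move=> ix0; rewrite -[x]rE ix0 linear0.
have [C [p S]] := ses_coker i_hom i_inj.
have C_proj := ses_proj_coker (res_ses S) r_hom rE (res_proj P_proj).
exists C; last exact: is_syzygyI P_proj S.
split=> // V; apply: Gproj_cosyz (T_Gproj V) (tp_proj (V := V) P_proj) (tp_ses V S C_proj) _.
exact: Mon_approx_extends.
Qed.

Lemma Gproj_Mon_Gproj n X : (forall W, pdim n W) -> Gproj X -> Mon_Gproj X.
Proof.
move=> B_n.
(* Every Gorenstein projective module is the syzygy of another one, so a common bound on the
   projective dimension of their restrictions to B can be lowered step by step to 0. *)
have all_proj Z : Gproj Z -> projective_mod (res Z).
  have: forall Z, Gproj Z -> pdim n (res Z) by move=> *; apply: B_n.
  elim: n {B_n} Z => [|n IHn] Z B_n; first exact: B_n.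
  apply: IHn => {}Z /Gproj_unfold[_ _ [Z' Z'_Gproj [[P i p P_proj S]]]].
  exact: pdim_syz (B_n _ Z'_Gproj) (res_proj P_proj) (res_ses S).
move=> X_Gproj; split=> [|V]; first exact: all_proj.
apply: (@Gproj_coind _ _ (fun Y => exists2 X, Gproj X & Y = outer_btens V X)); last by exists X.
move=> {X X_Gproj} _ [X X_Gproj ->].
have [ext [K K_Gproj KX] [Z Z_Gproj XZ]] := Gproj_unfold X_Gproj.
have syz (X1 X2 : fdmod L) : Gproj X2 -> is_syzygy X1 X2 ->
    is_syzygy (outer_btens V X1) (outer_btens V X2).
  move=> X2_Gproj [[P i p P_proj S]].
  exact: is_syzygyI (tp_proj (V := V) P_proj) (tp_ses V S (all_proj _ X2_Gproj)).
split; last 1 [by exists (outer_btens V K); [exists K | exact: syz]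
              |by exists (outer_btens V Z); [exists Z | exact: syz]].
case: KX => [[P i p P_proj S]].
apply: (ext1_of_ses (tp_proj (V := V) P_proj) (tp_ses V S (all_proj _ X_Gproj))).
apply: (tp_extends _ _ (ses_i S)).2.
have [s [r [s_hom r_hom _ rK]]] := tmod_hom2 A (isom_refl (codual V)).
apply: (extends_retract r_hom s_hom rK).
exact: Ext_pdim (Gproj_Ext X_Gproj) (tmod_pdim A (B_n _)) _ _ _ _ P_proj S.
Qed.

End MainDirections.

Theorem theorem4p5 (k : fieldType) (A B : falgType k) :
  Gorenstein B ->
  (forall X : fdmod (talg A B), Gproj X <-> Mon_in (@Gproj k A) X)
    <-> gldim_finite B.
Proof.
move=> B_Gor; split=> [GprojE | [n B_n] X].
  apply: gldim_of_Gproj_proj => // G /(tmod_Gproj A)/GprojE[G_Mon _].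
  by apply: (@tmod_proj_inv _ A); apply/Mon_res_proj.
have pdim_B (W : fdmod B) : pdim n W by exact: projdim_pdim (B_n W).
split=> [X_Gproj | [X_Mon T_Gproj]].
  by have [/Mon_res_proj] := Gproj_Mon_Gproj pdim_B X_Gproj.
by apply: Mon_Gproj_Gproj; split; first exact/Mon_res_proj.
Qed.
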